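(* Let $n\ge 2$ and let $T=\varphi(t)\,dt^2+t^2\psi(t)\,d\Theta^2$ be a smooth, nonsingular, rotationally symmetric tensor on $\mathbb{R}^n$. Then in a neighborhood of the origin $0\in\mathbb{R}^n$ there exists a smooth rotationally symmetric Riemannian metric of the form $$g=e^{2f(t)}\left[r'(t)^2\,dt^2+r(t)^2\,d\Theta^2\right],\qquad r(0)=0,\quad r'(0)=1,\quad r'(t)>0,$$ such that $\mathrm{Ric}(g)=T$. Moreover, such a metric is unique up to homothety: any two metrics of this form solving $\mathrm{Ric}(g)=T$ near the origin coincide, on a sufficiently small neighborhood of the origin, up to multiplication by a positive constant.
   Context: Here $t=|x|\ge 0$ is the Euclidean distance to the origin of $\mathbb{R}^n$, $\Theta=x/|x|\in\mathbb{S}^{n-1}$, and $d\Theta^2$ is the standard metric of the unit sphere $\mathbb{S}^{n-1}$. A symmetric 2-tensor $T$ on $\mathbb{R}^n$ is rotationally symmetric if $\gamma^*T=T$ for every $\gamma\in SO(n)$; here it is written in polar form as $T=\varphi(t)dt^2+t^2\psi(t)d\Theta^2$. Nonsingular means nondegenerate at every point. $\mathrm{Ric}(g)$ denotes the Ricci tensor of $g$ (with the convention that it is positive on round spheres). *)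

(* Defs.v *)
From HB Require Import structures.
From mathcomp Require Import all_boot all_order all_algebra.
From mathcomp Require Import all_classical all_reals all_analysis.

Set Implicit Arguments.
Unset Strict Implicit.
Unset Printing Implicit Defensive.

Import Order.TTheory GRing.Theory Num.Theory.
Import numFieldNormedType.Exports.

Local Open Scope classical_set_scope.
Local Open Scope ring_scope.

(* Points and tangent vectors of R^n are row vectors; a 2-tensor field T is a
   map x |-> T x to matrices, with T_x(v, w) = v *m T x *m w^T.  Matrices act
   on points and vectors from the right. *)

Section Euclidean.
Variables (R : realType) (n : nat).
Implicit Types (x v : 'rV[R]_n) (U : set 'rV[R]_n) (h : 'rV[R]_n -> R)
  (T g : 'rV[R]_n -> 'M[R]_n).

(* The library norm `|x| on row vectors is the sup norm. *)
Definition enorm x : R := Num.sqrt (\sum_(i < n) x 0 i ^+ 2).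

Definition eball (e : R) : set 'rV[R]_n := [set x | enorm x < e].

Definition partial (i : 'I_n) h : 'rV[R]_n -> R :=
  fun x => 'D_(delta_mx 0 i) h x.

Definition partials (s : seq 'I_n) h : 'rV[R]_n -> R := foldr partial h s.

(* Intended for open U. *)
Definition smooth_on U h : Prop :=
  forall (s : seq 'I_n) x, U x ->
    {for x, continuous (partials s h)} /\
    forall i, derivable (partials s h) x (delta_mx 0 i).

Definition smooth_tensor_on U T : Prop :=
  forall i j, smooth_on U (fun x => T x i j).

Definition symmetric_on U T : Prop := forall x, U x -> (T x)^T = T x.

Definition nonsingular_on U T : Prop := forall x, U x -> T x \in unitmx.

Definition special_orthogonal (A : 'M[R]_n) : Prop :=
  A *m A^T = 1%:M /\ \det A = 1.

(* Pullback along x |-> x *m A. *)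
Definition pullback (A : 'M[R]_n) T : 'rV[R]_n -> 'M[R]_n :=
  fun x => A *m T (x *m A) *m A^T.

(* Intended for SO(n)-invariant U. *)
Definition rotationally_symmetric_on U T : Prop :=
  forall A, special_orthogonal A -> forall x, U x -> pullback A T x = T x.

Definition riemannian_on U g : Prop :=
  [/\ smooth_tensor_on U g, symmetric_on U g &
      forall x, U x -> forall v, v != 0 -> 0 < (v *m g x *m v^T) 0 0].

Definition Theta x : 'rV[R]_n := (enorm x)^-1 *: x.

(* dt^2, and the pullback by Theta of the metric that the unit sphere inherits
   from R^n; both are meaningful only for x != 0. *)
Definition dt2 x : 'M[R]_n :=
  \matrix_(i, j) (partial i enorm x * partial j enorm x).

Definition dTheta2 x : 'M[R]_n :=
  \matrix_(i, j) \sum_(k < n)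
    partial i (fun y => Theta y 0 k) x * partial j (fun y => Theta y 0 k) x.

Definition polar_on U T (a b : R -> R) : Prop :=
  forall x, U x -> x != 0 ->
    T x = a (enorm x) *: dt2 x + b (enorm x) *: dTheta2 x.

(* christoffel g k i j is Gamma^k_ij. *)
Definition christoffel g (k i j : 'I_n) : 'rV[R]_n -> R := fun x =>
  2^-1 * \sum_(l < n) invmx (g x) k l *
    (partial i (fun y => g y j l) x + partial j (fun y => g y i l) x
     - partial l (fun y => g y i j) x).

(* curvature g l k i j is R^l_kij, the d_l-component of
   (nabla_i nabla_j - nabla_j nabla_i) d_k. *)
Definition curvature g (l k i j : 'I_n) : 'rV[R]_n -> R := fun x =>
  partial i (christoffel g l j k) x - partial j (christoffel g l i k) x
  + \sum_(m < n) (christoffel g l i m x * christoffel g m j k x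
                  - christoffel g l j m x * christoffel g m i k x).

Definition Ric g : 'rV[R]_n -> 'M[R]_n := fun x =>
  \matrix_(j, k) \sum_(i < n) curvature g i k i j x.

End Euclidean.

Section Metrics.
Variables (R : realType) (n : nat).

Definition smooth1_on (U : set R) (h : R -> R) : Prop :=
  forall k t, U t -> derivable (derive1n k h) t 1.

(* Smoothness of f and r on [0, e) up to the endpoint 0 is expressed by taking
   them to be restrictions of smooth functions on (-e, e); their values at
   negative arguments play no role, and r'(0) is then an ordinary derivative. *)
Definition radial_metric (e : R) (f r : R -> R) (g : 'rV[R]_n -> 'M[R]_n)
    : Prop :=
  [/\ riemannian_on (eball e) g, rotationally_symmetric_on (eball e) g,
      smooth1_on `]- e, e[ f /\ smooth1_on `]- e, e[ r,
      [/\ r 0 = 0, derive1 r 0 = 1 & forall t, 0 <= t < e -> 0 < derive1 r t] &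
      polar_on (eball e) g (fun t => expR (2 * f t) * derive1 r t ^+ 2)
                           (fun t => expR (2 * f t) * r t ^+ 2)].

Definition radial_solution (T : 'rV[R]_n -> 'M[R]_n) (e : R)
    (g : 'rV[R]_n -> 'M[R]_n) : Prop :=
  (exists f r : R -> R, radial_metric e f r g) /\
  forall x, eball e x -> Ric g x = T x.

End Metrics.

(* Main.v *)
Require Import Defs.
From mathcomp Require Import all_boot all_order all_algebra.
From mathcomp Require Import all_classical all_reals all_analysis.
From mathcomp Require Import ring lra.
Import Order.TTheory GRing.Theory Num.Theory.
Import numFieldNormedType.Exports.
Local Open Scope classical_set_scope.
Local Open Scope ring_scope.

(** The constant [c] is the common value of [phi] and [psi] at 0: a smooth [T] of polar form must be
    a multiple of the identity at the origin, and [c] is nonzero because [T] is nonsingular. At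
    [t = 0] one has [y = 2 v], and the reduced equation becomes a quadratic in [v(0)] with roots
    [c/2] and [-c/(2(n-1))]. The first would give [h(0) = -1/(n-1)], so positivity of [h] selects
    the second; this is the origin of the ansatz for [p]. Then [y = -(c/(n-1)) (1 + t^2 Z)] with
    [2 Z = t z' + 4 z], and the linear part [2 Z + (n-2) z] of the equation is [t z' + (n+2) z].

    The obstacle throughout is that [t = |x|] is not smooth at the origin. Even smooth functions of
    [t] do give smooth functions of [x], so existence carries parity through every construction, and
    the curvature is computed in Cartesian coordinates, where the formulas hold at the origin as
    well. Uniqueness starts from [f] and [r] without any parity, so it works at [t > 0] and reaches
    the origin by continuity. *)

(** The idea: writing a metric of the required form as
    [g = A (1 + (2 k + t^2 k^2) x^T x)] with [A = e^(2f) r^2 / t^2] and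
    [h = 1 + t^2 k = t r'/r], and putting [p = t^2 v = f' r/r'], the equation
    [Ric g = T] becomes
      [phi = - (n-1) y h],  [psi = - (y/h + (n-2) (2 p + p^2) / t^2)],  [y = p'/t].
    Eliminating [h] leaves the first-order equation
      [(n-1) y^2 = phi (psi + (n-2) (2 p + p^2) / t^2)]
    for [p] alone, in which the sign of [y] is forced by [h > 0].

    Uniqueness: for two solutions the difference [w] of the profiles [p] vanishes
    at [0] and satisfies [w w' <= 0], so [w = 0]; then [y] and [h] agree, hence so
    do [r'/r] and [f'].

    Existence: with [phi = c (1 + t^2 a)], [psi = c (1 + t^2 b)] and
    [p = - (c / (2 (n-1))) t^2 (1 + t^2 z)] the equation becomes
    [t z' + (n+2) z = A0 + t^2 B(t, z, t z')]. The operator [t d/dt + (n+2)] is inverted by a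
    weighted mean, the factor [t^2] makes the fixed-point problem contracting near
    [0], and multiplication of the mean by [t] gains a derivative, so that the
    continuous solution is smooth. *)

Set Implicit Arguments.
Unset Strict Implicit.
Unset Printing Implicit Defensive.

(** * Calculus on an interval around the origin *)

(* A copy of [is_derive] that typeclass resolution does not see. *)
Definition hasD {R : numFieldType} {V : normedModType R} (x v : V) (f : V -> R) (a : R) :=
  is_derive x v f a.

Section DerivePointwise.
Context {R : realType} {V : normedModType R}.
Implicit Types (f g : V -> R) (x v : V).

Lemma derP f x v a : hasD x v f a <-> derivable f x v /\ 'D_v f x = a.
Proof. by split=> -[d e]; split. Qed.

Lemma derD f g x v a b : hasD x v f a -> hasD x v g b ->
  hasD x v (fun y => f y + g y) (a + b).
Proof. exact: is_deriveD. Qed.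

Lemma derN f x v a : hasD x v f a -> hasD x v (fun y => - f y) (- a).
Proof. exact: is_deriveN. Qed.

Lemma derB f g x v a b : hasD x v f a -> hasD x v g b ->
  hasD x v (fun y => f y - g y) (a - b).
Proof. exact: is_deriveB. Qed.

Lemma der_eq f x v a b : hasD x v f a -> a = b -> hasD x v f b.
Proof. by move=> ? <-. Qed.

Lemma derM f g x v a b : hasD x v f a -> hasD x v g b ->
  hasD x v (fun y => f y * g y) (a * g x + f x * b).
Proof.
move=> df dg; apply: (@der_eq _ _ _ _ _ (is_deriveM df dg)).
by rewrite /GRing.scale/= addrC [g x * a]mulrC.
Qed.

Lemma derV f x v a : f x != 0 -> hasD x v f a ->
  hasD x v (fun y => (f y)^-1) (- a / f x ^+ 2).
Proof.
move=> f0 [dfx <-]; apply/derP; split; first exact: derivableV.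
by rewrite deriveV// /GRing.scale/= mulrC mulNr mulrN.
Qed.

Lemma derX f n x v a : hasD x v f a ->
  hasD x v (fun y => f y ^+ n) (n%:R * f x ^+ n.-1 * a).
Proof.
move=> df; have -> : (fun y => f y ^+ n) = f ^+ n by rewrite exprfctE.
exact: is_deriveX.
Qed.

Lemma der_cst (c : R) x v : hasD x v (fun _ : V => c) 0.
Proof. exact: is_derive_cst. Qed.

(** Reduces directional derivatives to derivatives along a line, where the one-variable chain rule
    is available ([der_comp]). *)
Lemma der_line f x v a :
  hasD x v f a <-> hasD (0 : R) (1 : R) (fun h : R => f (h *: v + x)) a.
Proof.
have E : 'D_v f x = 'D_1 (fun h : R => f (h *: v + x)) 0.
  rewrite /derive; set g1 := fun h => h^-1 *: _; set g2 := fun h => h^-1 *: _.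
  suff -> : g1 = g2 by [].
  by rewrite funeqE /g1 /g2 => h /=; rewrite addr0 scale0r add0r [_%:A]mulr1.
split=> -[d <-].
  by split; [exact: (derivable1P f x v).1|rewrite E].
by split; [exact: (derivable1P f x v).2|rewrite E].
Qed.

Lemma der_comp (F : R -> R) f x v a b :
  hasD (f x : R) (1 : R) F a -> hasD x v f b ->
  hasD x v (fun y => F (f y)) (a * b).
Proof.
move=> dF /der_line df; apply/der_line.
apply: (@is_derive1_comp _ F (fun h : R => f (h *: v + x))) => //.
by rewrite scale0r add0r.
Qed.

Lemma der_near f g x v a : (\forall y \near x, f y = g y) ->
  hasD x v f a -> hasD x v g a.
Proof. exact: near_eq_is_derive. Qed.

Lemma der_val f x v a : hasD x v f a -> 'D_v f x = a.
Proof. by case. Qed.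

Lemma der_unique f x v a b : hasD x v f a -> hasD x v f b -> a = b.
Proof. by move=> /der_val <- /der_val <-. Qed.

End DerivePointwise.

Lemma der_id {R : realType} (x : R) : hasD x (1 : R) (fun y : R => y) 1.
Proof. exact: is_derive_id. Qed.

Lemma der_cont {R : realType} (f : R -> R) (x a : R) :
  hasD x (1 : R) f a -> {for x, continuous f}.
Proof. by move=> [/derivable1_diffP/differentiable_continuous]. Qed.

Lemma der_slope {R : realType} (f : R -> R) (x a : R) :
  hasD x (1 : R) f a <->
  exists g : R -> R, [/\ forall z, f z - f x = g z * (z - x),
                         {for x, continuous g} & g x = a].
Proof. exact: is_derive1_caratheodory. Qed.

Section Interval.
Context {R : realType}.
Implicit Types (e d s t : R) (f g h : R -> R).

Lemma near_ball0 e t : `|t| < e -> \forall s \near t, `|s| < e.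
Proof.
move=> te; have c : (fun s : R => s) s @[s --> t] --> t by exact: cvg_id.
exact: (cvgr_norm_lt t c e te).
Qed.

Lemma near_neq0 t : t != 0 -> \forall s \near t, s != 0.
Proof. move=> t0; have c : (fun s : R => s) s @[s --> t] --> t by exact: cvg_id.
exact: (cvgr_neq0 t c t0). Qed.

Definition CtOn e f := forall t, `|t| < e -> {for t, continuous f}.

Lemma within_CtOn e f a b : CtOn e f -> - e < a -> b < e ->
  {within `[a, b], continuous f}.
Proof.
move=> cf ea be; apply: continuous_in_subspaceT => x.
rewrite inE/= in_itv/= => /andP[ax xb]; apply: cf.
by rewrite ltr_norml (lt_le_trans ea ax) (le_lt_trans xb be).
Qed.

(** A mean value theorem based at 0, for [t] of either sign, that asks for no derivative at 0:
    quotients by powers of [t] are at first differentiable only off 0. *)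
Lemma mvt0 e f f1 t : CtOn e f ->
  (forall s : R, `|s| < e -> s != 0 -> hasD s (1 : R) f (f1 s)) ->
  `|t| < e -> t != 0 ->
  exists s, [/\ s != 0, `|s| < `|t|, 0 < s * t & f t - f 0 = f1 s * t].
Proof.
move=> cf df te t0; have /andP[te1 te2] : - e < t < e by rewrite -ltr_norml.
have e0 : 0 < e by apply: le_lt_trans te.
move: t0; rewrite neq_lt => /orP[tn|tp].
- have [||s] := @MVT _ f f1 t 0 tn.
  + move=> s; rewrite in_itv/= => /andP[ts s0]; apply: df; last by rewrite lt_eqF.
    by rewrite ltr_norml; apply/andP; split; lra.
  + by apply: within_CtOn cf _ _.
  rewrite in_itv/= => /andP[ts s0] E; exists s; split.
  + by rewrite lt_eqF.
  + by rewrite !ltr0_norm// ltrN2.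
  + by rewrite nmulr_rgt0.
  + by rewrite sub0r mulrN in E; lra.
- have [||s] := @MVT _ f f1 0 t tp.
  + move=> s; rewrite in_itv/= => /andP[s0 ts]; apply: df; last by rewrite gt_eqF.
    by rewrite ltr_norml; apply/andP; split; lra.
  + by apply: within_CtOn cf _ _ => //; lra.
  rewrite in_itv/= => /andP[s0 ts] E; exists s; split.
  + by rewrite gt_eqF.
  + by rewrite !gtr0_norm.
  + by rewrite pmulr_rgt0.
  + by rewrite subr0 in E.
Qed.

Lemma cst_off0 e f : CtOn e f ->
  (forall s : R, `|s| < e -> s != 0 -> hasD s (1 : R) f 0) ->
  forall t, `|t| < e -> f t = f 0.
Proof.
move=> cf df t te; have [->//|t0] := eqVneq t 0.
have [s [_ _ _ /eqP]] := mvt0 cf df te t0.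
by rewrite mul0r subr_eq0 => /eqP.
Qed.

Lemma der_CtOn e f f1 : (forall s, `|s| < e -> hasD s (1 : R) f (f1 s)) -> CtOn e f.
Proof. by move=> df t te; apply: der_cont (df t te). Qed.

Lemma CtOn_ext e f g : (forall t, `|t| < e -> f t = g t) -> CtOn e f -> CtOn e g.
Proof.
move=> E cf t te; have := cf t te; rewrite /prop_for /continuous_at -(E t te).
apply: cvg_trans; apply: near_eq_cvg; near=> s; apply: E.
near: s; exact: near_ball0.
Unshelve. all: by end_near. Qed.

Lemma eq_ball_near e f g t : (forall t, `|t| < e -> f t = g t) -> `|t| < e ->
  \forall s \near t, f s = g s.
Proof.
by move=> E te; near=> s; apply: E; near: s; exact: near_ball0.
Unshelve. all: by end_near. Qed.

(** Retraction onto [[-e, e]]. Precomposition with it extends a function given near 0 to the whole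
    line and preserves continuity and parity. *)
Definition clamp e t := Num.max (- e) (Num.min e t).

Lemma clamp_le e t : 0 <= e -> `|clamp e t| <= e.
Proof. by move=> e0; rewrite ler_norml /clamp le_max lexx/= ge_max ge_min lexx/= andbT; lra. Qed.

Lemma clamp_id e t : `|t| <= e -> clamp e t = t.
Proof. by rewrite ler_norml /clamp => /andP[a b]; rewrite min_r// max_r. Qed.

Lemma clampN e t : 0 <= e -> clamp e (- t) = - clamp e t.
Proof.
move=> e0; rewrite /clamp; have [te|te] := leP `|t| e.
  move: te; rewrite ler_norml => /andP[a b].
  by rewrite !min_r ?max_r//; lra.
move: te; rewrite lter_normr => /orP[te|te].
  by rewrite [Num.min e t]min_l ?min_r ?[Num.max _ e]max_r ?max_l//; lra.
by rewrite [Num.min e t]min_r ?[Num.min e _]min_l ?[Num.max _ e]max_r ?max_l ?opprK//; lra.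
Qed.

Lemma clamp_cont e : continuous (clamp e).
Proof.
move=> t; apply: (@continuous_max R R (fun=> - e) (fun s => Num.min e s) t).
  exact: cvg_cst.
by apply: (@continuous_min R R (fun=> e) (fun s => s) t); [exact: cvg_cst|exact: cvg_id].
Qed.

Lemma antiderivative_clamped e f : 0 < e -> continuous f ->
  exists F, forall t, `|t| < e -> hasD t (1 : R) F (f t).
Proof.
move=> e0 cf.
exists (fun x => \int[lebesgue_measure]_(t in `[- e, x]) f t)%R => t.
rewrite ltr_norml => /andP[t1 t2].
have [|d E] := @continuous_FTC1_closed R f (- e) t e t2 _ t1 (cf t).
  apply: continuous_compact_integrable; first exact: segment_compact.
  exact: continuous_subspaceT.
by split; [exact: d|rewrite -derive1E; exact: E].
Qed.

(** Since [f] may be unbounded towards the ends of the open interval, antiderivatives on smaller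
    intervals are glued. *)
Lemma antiderivative e f : CtOn e f ->
  exists F, F 0 = 0 /\ forall t, `|t| < e -> hasD t (1 : R) F (f t).
Proof.
move=> cf; have [e0|e0] := leP e 0.
  exists (fun=> 0); split=> // t te; exfalso.
  by move: (le_lt_trans (normr_ge0 t) te); rewrite ltNge e0.
have H d : exists F, (0 < d < e) -> F 0 = 0 /\
    forall t, `|t| < d -> hasD t (1 : R) F (f t).
  have [/andP[d0 de]|] := boolP (0 < d < e); last by exists (fun=> 0).
  have [|F dF] := @antiderivative_clamped d (f \o clamp d) d0.
    move=> t; apply: continuous_comp; first exact: clamp_cont.
    by apply: cf; apply: le_lt_trans de; apply: clamp_le; exact: ltW.
  exists (fun t => F t - F 0) => _; split; first by rewrite subrr.
  move=> t td; rewrite -[f t]subr0; apply: derB; last exact: der_cst.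
  by apply: der_eq (dF t td) _; rewrite /= clamp_id// ltW.
have [F HF] := choice H.
(* [m t] lies strictly between [|t|] and [e]. Antiderivatives for different radii vanish at 0, hence
   agree where both are valid, so [F (m t) t] is locally one of them. *)
pose m t := (`|t| + e) / 2.
have mP t : `|t| < e -> 0 < m t < e /\ `|t| < m t.
  by rewrite /m; have := normr_ge0 t; split; [apply/andP; split|]; lra.
have Fu d d' t : 0 < d < e -> 0 < d' < e -> `|t| < d -> `|t| < d' -> F d t = F d' t.
  move=> dd dd' td td'.
  wlog ldd : d d' dd dd' td td' / d <= d'.
    move=> W; have [?|/ltW ?] := leP d d'; first exact: W.
    by apply/esym; apply: W.
  have [F0 dF] := HF d dd; have [F0' dF'] := HF d' dd'.
  have D s : `|s| < d -> hasD s (1 : R) (fun x => F d x - F d' x) 0.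
    move=> sd; rewrite -(subrr (f s)); apply: derB; first exact: dF.
    by apply: dF'; exact: lt_le_trans ldd.
  have := @cst_off0 d _ (der_CtOn D) (fun s sd _ => D s sd) t td.
  by rewrite F0 F0' subrr => /eqP; rewrite subr_eq0 => /eqP.
exists (fun t => F (m t) t); split.
  have [H0 _] := mP 0 (ltac:(by rewrite normr0)).
  by have [] := HF _ H0.
move=> t te; have [mt tm] := mP t te; have [_ dF] := HF _ mt.
apply: der_near (dF t tm); near=> s.
have sm : `|s| < m t by near: s; exact: near_ball0.
have se : `|s| < e by near: s; exact: near_ball0.
have [ms sm'] := mP s se.
exact: Fu.
Unshelve. all: by end_near. Qed.

End Interval.

(** * Regularity classes and weighted means *)

Section Regularity.
Context {R : realType}.
Implicit Types (e d s t : R) (f g h : R -> R) (k a : nat).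

(** The derivative is an existential witness rather than [derive1 f], so that each closure lemma
    supplies its own formula and induction on [k] goes through. *)
Fixpoint CkOn k e f : Prop :=
  match k with
  | 0%N => CtOn e f
  | k'.+1 => exists f1, (forall t, `|t| < e -> hasD t (1 : R) f (f1 t)) /\ CkOn k' e f1
  end.

Definition smoothOn e f := forall k, CkOn k e f.

Lemma hasD_ext e f g t x : (forall t, `|t| < e -> f t = g t) -> `|t| < e ->
  hasD t (1 : R) f x -> hasD t (1 : R) g x.
Proof. by move=> E te; apply: der_near; exact: eq_ball_near E te. Qed.

Lemma CkOn_ext k e f g : (forall t, `|t| < e -> f t = g t) ->
  CkOn k e f -> CkOn k e g.
Proof.
move=> E; case: k => [|k]; first exact: CtOn_ext.
by move=> [f1 [df cf]]; exists f1; split=> // t te; apply: hasD_ext E te (df t te).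
Qed.

Lemma CkOnW k e f : CkOn k.+1 e f -> CkOn k e f.
Proof.
elim: k f => [|k IH] f [f1 [df cf]]; first exact: der_CtOn df.
by exists f1; split=> //; exact: IH.
Qed.

Lemma CkOn_CtOn k e f : CkOn k e f -> CtOn e f.
Proof. by elim: k => // k IH /CkOnW. Qed.

Lemma CkOn_sub k e d f : d <= e -> CkOn k e f -> CkOn k d f.
Proof.
move=> de; elim: k f => [|k IH] f; first by move=> cf t td; apply: cf; exact: lt_le_trans de.
move=> [f1 [df cf]]; exists f1; split; last exact: IH.
by move=> t td; apply: df; exact: lt_le_trans de.
Qed.

Lemma CkOn_cst k e (c : R) : CkOn k e (fun=> c).
Proof.
elim: k c => [|k IH] c; first by move=> t te; exact: cvg_cst.
by exists (fun=> 0); split=> // t te; exact: der_cst.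
Qed.

Lemma CkOn_id k e : CkOn k e (fun t => t).
Proof.
case: k => [|k]; first by move=> t te; exact: cvg_id.
by exists (fun=> 1); split; [move=> t te; exact: der_id|exact: CkOn_cst].
Qed.

Lemma CkOnD k e f g : CkOn k e f -> CkOn k e g -> CkOn k e (fun t => f t + g t).
Proof.
elim: k f g => [|k IH] f g; first by move=> cf cg t te; apply: cvgD; [exact: cf|exact: cg].
move=> [f1 [df cf]] [g1 [dg cg]]; exists (fun t => f1 t + g1 t); split; last exact: IH.
by move=> t te; apply: derD; [exact: df|exact: dg].
Qed.

Lemma CkOnM k e f g : CkOn k e f -> CkOn k e g -> CkOn k e (fun t => f t * g t).
Proof.
elim: k f g => [|k IH] f g; first by move=> cf cg t te; apply: cvgM; [exact: cf|exact: cg].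
move=> cf' cg'; have cf0 := CkOnW cf'; have cg0 := CkOnW cg'.
move: cf' cg' => [f1 [df cf]] [g1 [dg cg]].
exists (fun t => f1 t * g t + f t * g1 t); split; last by apply: CkOnD; apply: IH.
by move=> t te; apply: derM; [exact: df|exact: dg].
Qed.

Lemma CkOnZ k e c f : CkOn k e f -> CkOn k e (fun t => c * f t).
Proof. by apply: CkOnM; exact: CkOn_cst. Qed.

Lemma CkOnN k e f : CkOn k e f -> CkOn k e (fun t => - f t).
Proof. by move=> /(CkOnZ (-1)); apply: CkOn_ext => t _; rewrite mulN1r. Qed.

Lemma CkOnB k e f g : CkOn k e f -> CkOn k e g -> CkOn k e (fun t => f t - g t).
Proof. by move=> cf cg; apply: CkOnD => //; exact: CkOnN. Qed.

Lemma CkOnX k e f n : CkOn k e f -> CkOn k e (fun t => f t ^+ n).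
Proof.
move=> cf; elim: n => [|n IH]; first exact: (CkOn_cst k e 1).
by apply: (@CkOn_ext _ _ (fun t => f t * f t ^+ n)); [move=> t _; rewrite exprS|exact: CkOnM].
Qed.

(** The derivative of the inverse contains the inverse again, so its regularity at order [k] yields
    order [k.+1]; [CkOn_exp] and [CkOn_sqrt] use the same bootstrap. *)
Lemma CkOnV k e f : (forall t, `|t| < e -> f t != 0) -> CkOn k e f ->
  CkOn k e (fun t => (f t)^-1).
Proof.
move=> f0; elim: k => [|k IH]; first by move=> cf t te; apply: cvgV; [exact: f0|exact: cf].
move=> cf'; have /IH c0 := CkOnW cf'; move: cf' => [f1 [df cf]].
exists (fun t => - f1 t * (f t)^-1 ^+ 2); split; last by apply: CkOnM; [exact: CkOnN|exact: CkOnX].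
by move=> t te; rewrite exprVn; apply: derV; [exact: f0|exact: df].
Qed.

Lemma CkOn_exp k e f : CkOn k e f -> CkOn k e (fun t => expR (f t)).
Proof.
elim: k => [|k IH].
  by move=> cf t te; apply: continuous_comp; [exact: cf|exact: continuous_expR].
move=> cf'; have /IH c0 := CkOnW cf'; move: cf' => [f1 [df cf]].
exists (fun t => expR (f t) * f1 t); split; last exact: CkOnM.
by move=> t te; apply: der_comp (df t te); exact: is_derive_expR.
Qed.

Lemma CkOn_sqrt k e f : (forall t, `|t| < e -> 0 < f t) -> CkOn k e f ->
  CkOn k e (fun t => Num.sqrt (f t)).
Proof.
move=> f0; elim: k => [|k IH].
  by move=> cf t te; apply: continuous_comp; [exact: cf|exact: sqrt_continuous].
move=> cf'; have /IH c0 := CkOnW cf'; move: cf' => [f1 [df cf]].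
exists (fun t => (2 * Num.sqrt (f t))^-1 * f1 t); split.
  by move=> t te; apply: der_comp (df t te); apply: is_derive1_sqrt; exact: f0.
apply: CkOnM => //; apply: CkOnV; last exact: CkOnZ.
by move=> t te; rewrite mulf_neq0// gt_eqF// sqrtr_gt0; exact: f0.
Qed.

End Regularity.

(** * Weighted means as inverses of [t d/dt + a] *)

Section Average.
Context {R : realType}.
Implicit Types (e d s t : R) (f g h : R -> R) (k a : nat).

Definition primitive e f : R -> R :=
  xget (fun=> 0) [set F : R -> R | F 0 = 0 /\ forall t, `|t| < e -> hasD t (1 : R) F (f t)].

Lemma primitiveP e f : CtOn e f -> primitive e f 0 = 0 /\
  forall t, `|t| < e -> hasD t (1 : R) (primitive e f) (f t).
Proof.
move=> /antiderivative[F HF].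
exact: (@xgetPex _ (fun=> 0) [set F : R -> R | F 0 = 0 /\ forall t, `|t| < e -> hasD t (1 : R) F (f t)] (ex_intro _ F HF)).
Qed.

(* The weighted mean [\int_0^1 x^(a-1) h(t x) dx], written without an integral. *)
Definition wmean e a h : R -> R := fun t =>
  if t == 0 then h 0 / a%:R else primitive e (fun s => s ^+ a.-1 * h s) t / t ^+ a.

Section WmeanTheory.
Variables (e : R) (a : nat).
Hypothesis a0 : (0 < a)%N.

Let aR : a%:R != 0 :> R. Proof. by rewrite pnatr_eq0 -lt0n. Qed.

Lemma wmean_cts h : CtOn e h -> CtOn e (fun s => s ^+ a.-1 * h s).
Proof. by move=> ch; apply: (@CkOnM R 0) => //; apply: (@CkOnX R 0); exact: (@CkOn_id R 0). Qed.

(* Cauchy's mean value theorem for the primitive against [t ^+ a]. *)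
Lemma wmean_mvt h t : CtOn e h -> `|t| < e ->
  exists2 s, `|s| <= `|t| & wmean e a h t = h s / a%:R.
Proof.
move=> ch te; rewrite /wmean; have [->|t0] := eqVneq t 0; first by exists 0.
have [F0 dF] := primitiveP (wmean_cts ch); set F := primitive _ _ in F0 dF *.
pose G s := F s * t ^+ a - F t * s ^+ a.
have dG s : `|s| < e -> hasD s (1 : R) G (s ^+ a.-1 * (h s * t ^+ a - F t * a%:R)).
  move=> se; apply: der_eq.
    apply: derB; first by apply: derM; [exact: dF|exact: der_cst].
    by apply: derM; [exact: der_cst|apply: derX; exact: der_id].
  by rewrite /=; ring.
have [s [s0 st _ E]] := mvt0 (der_CtOn dG) (fun s se _ => dG s se) te t0.
exists s; first exact: ltW.
have ta : t ^+ a != 0 by rewrite expf_neq0.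
have : s ^+ a.-1 * (h s * t ^+ a - F t * a%:R) = 0.
  apply: (mulIf t0); rewrite mul0r -E /G F0 expr0n eqn0Ngt a0 /=; ring.
move/eqP; rewrite mulf_eq0 expf_eq0 (negbTE s0) andbF/= subr_eq0 => /eqP E'.
by apply/eqP; rewrite eqr_div// E' .
Qed.

(** Equivalently [t y' + a y = h] for the mean [y]: this equation is what the mean is for. *)
Lemma wmean_der h t : CtOn e h -> `|t| < e -> t != 0 ->
  hasD t (1 : R) (wmean e a h) ((h t - a%:R * wmean e a h t) / t).
Proof.
move=> ch te t0; have [F0 dF] := primitiveP (wmean_cts ch).
apply: (@der_near _ _ (fun t => primitive e (fun s => s ^+ a.-1 * h s) t / t ^+ a)).
  near=> s; rewrite /wmean; have /negbTE-> // : s != 0.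
  by near: s; exact: near_neq0.
have ta : t ^+ a != 0 by rewrite expf_neq0.
apply: der_eq.
  apply: derM; first exact: dF.
  by apply: derV; [exact: ta|apply: derX; exact: der_id].
rewrite /wmean (negbTE t0); set F := primitive _ _ t.
have E : t ^+ a = t * t ^+ a.-1 by rewrite -exprS prednK.
have tb : t ^+ a.-1 != 0 by rewrite expf_neq0.
by rewrite E; field; rewrite t0 tb.
Unshelve. all: by end_near. Qed.

Lemma wmean0 h : wmean e a h 0 = h 0 / a%:R.
Proof. by rewrite /wmean eqxx. Qed.

Lemma wmean_CtOn h : CtOn e h -> CtOn e (wmean e a h).
Proof.
move=> ch t te; have [t0|t0] := eqVneq t 0; last exact: der_cont (wmean_der ch te t0).
rewrite t0 in te *; rewrite /prop_for /continuous_at wmean0.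
have e0 : 0 < e by rewrite normr0 in te.
apply/cvgrPdist_lt => /= eps eps0.
have /cvgrPdist_lt/(_ (eps * a%:R)) := ch 0 te.
rewrite mulr_gt0 ?ltr0n// => /(_ isT) /nbhs_ballP[d /= d0 D].
near=> s.
have se : `|s| < e by near: s; exact: near_ball0.
have sd : `|s| < d by near: s; apply: near_ball0; rewrite normr0.
have [u us ->] := wmean_mvt ch se.
rewrite -mulrBl normrM normfV (ger0_norm (ler0n _ _)) ltr_pdivrMr ?ltr0n//.
by apply: D; rewrite /ball/= sub0r normrN; exact: le_lt_trans sd.
Unshelve. all: by end_near. Qed.

(** On each side of 0 the homogeneous solutions are multiples of [t^(-a)], so continuity at 0
    singles out the mean. Additivity, parity and the derivative of means are all deduced from this
    characterization. *)
Lemma wmean_unique h y : CtOn e h -> CtOn e y ->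
  (forall t, `|t| < e -> t != 0 -> hasD t (1 : R) y ((h t - a%:R * y t) / t)) ->
  forall t, `|t| < e -> y t = wmean e a h t.
Proof.
move=> ch cy dy t te.
have dl s := @wmean_der h s ch.
have dz s : `|s| < e -> s != 0 -> hasD s (1 : R) (fun s => s ^+ a * (y s - wmean e a h s)) 0.
  move=> se s0; apply: der_eq.
    apply: derM; first by apply: derX; exact: der_id.
    by apply: derB; [exact: dy|exact: dl].
  have E : s ^+ a = s * s ^+ a.-1 by rewrite -exprS prednK.
  by rewrite E; field.
have cz : CtOn e (fun s => s ^+ a * (y s - wmean e a h s)).
  apply: (@CkOnM R 0); first by apply: (@CkOnX R 0); exact: (@CkOn_id R 0).
  by apply: (@CkOnB R 0) => //; exact: wmean_CtOn.
have Z s : `|s| < e -> s != 0 -> y s = wmean e a h s.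
  move=> se s0; have /eqP := cst_off0 cz dz se.
  rewrite expr0n eqn0Ngt a0/= mul0r mulf_eq0 expf_eq0 (negbTE s0) andbF/=.
  by rewrite subr_eq0 => /eqP.
(* At 0 the factor [s ^+ a] hides the difference; equality there follows by continuity from nearby
   [s]. *)
have [t0|/Z ->//] := eqVneq t 0; rewrite t0 in te *.
apply/eqP; rewrite -subr_eq0 -normr_eq0; apply/eqP/le_anti; rewrite normr_ge0 andbT.
have c0 : CtOn e (fun s => y s - wmean e a h s) by apply: (@CkOnB R 0) => //; exact: wmean_CtOn.
have e0 : 0 < e by rewrite normr0 in te.
apply/ler_addgt0Pl => eps eps0; rewrite addr0.
have /cvgrPdist_lt/(_ eps eps0)/nbhs_ballP[d /= d0 D] := c0 0 te.
pose s := Num.min d e / 2.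
have m0 : 0 < Num.min d e by rewrite lt_min d0 e0.
have s0 : 0 < s by rewrite /s; lra.
have [sd se] : s < d /\ s < e.
  have : s < Num.min d e by rewrite /s; lra.
  by rewrite lt_min => /andP.
have := D s; rewrite /ball/= sub0r normrN gtr0_norm// => /(_ sd).
have -> : y s = wmean e a h s by apply: Z; rewrite ?gtr0_norm ?gt_eqF.
by rewrite subrr subr0 => /ltW.
Qed.

Lemma wmeanB h g t : CtOn e h -> CtOn e g -> `|t| < e ->
  wmean e a (fun s => h s - g s) t = wmean e a h t - wmean e a g t.
Proof.
move=> ch cg te; apply/esym.
apply: (@wmean_unique (fun s => h s - g s) (fun t => wmean e a h t - wmean e a g t)) => //.
- exact: (@CkOnB R 0).
- by apply: (@CkOnB R 0); exact: wmean_CtOn.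
move=> s se s0; apply: der_eq; first by apply: derB; exact: wmean_der.
by field.
Qed.

Lemma wmean_even h : CtOn e h -> (forall t, `|t| < e -> h (- t) = h t) ->
  forall t, `|t| < e -> wmean e a h (- t) = wmean e a h t.
Proof.
move=> ch ev; apply: wmean_unique => //.
  move=> t te; apply: continuous_comp; first exact: opp_continuous.
  by apply: wmean_CtOn; rewrite ?normrN.
move=> t te t0; apply: der_eq.
  apply: (@der_comp R R (wmean e a h) (fun t => - t)); last by apply: derN; exact: der_id.
  by apply: wmean_der; rewrite ?normrN ?oppr_eq0.
by rewrite /= ev//; field.
Qed.

Lemma wmean_bound h t (M : R) : CtOn e h -> `|t| < e ->
  (forall s, `|s| <= `|t| -> `|h s| <= M) -> `|wmean e a h t| <= M.
Proof.
move=> ch te hM; have [s st ->] := wmean_mvt ch te.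
have M0 : 0 <= M by apply: le_trans (hM s st); exact: normr_ge0.
rewrite normrM normfV (ger0_norm (ler0n _ _)) ler_pdivrMr ?ltr0n//.
apply: (le_trans (hM s st)); rewrite ler_peMr// ler1n; exact: a0.
Qed.

(** From [t y' = h - a y] the derivative of [t y] is [h - (a-1) y], in which no division by [t]
    remains. *)
Lemma wmean_gain k h : CkOn k e h -> CkOn k e (wmean e a h) ->
  CkOn k.+1 e (fun t => t * wmean e a h t).
Proof.
move=> ch cL; have h0 := CkOn_CtOn ch.
exists (fun t => h t - (a%:R - 1) * wmean e a h t); split; last first.
  by apply: CkOnB => //; exact: CkOnZ.
move=> t te; have [t0|t0] := eqVneq t 0.
  (* At 0 the difference quotient of [t y] is [y] itself. *)
  rewrite t0 in te *; apply/der_slope; exists (wmean e a h); split.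
  - by move=> z; rewrite mul0r !subr0 mulrC.
  - exact: wmean_CtOn.
  - by rewrite wmean0; field.
apply: der_eq; first by apply: derM; [exact: der_id|exact: wmean_der].
by rewrite /=; field.
Qed.

End WmeanTheory.

(** Formally, differentiating [t y' + a y = h] gives [t (y')' + (a+1) y' = h']. As differentiability
    of [y] at 0 is not yet known, the argument runs backwards: integrate the mean of [h1] to [W],
    check the first-order equation for [W], and identify [W] by uniqueness. *)
Lemma wmean_derS e a h h1 : (0 < a)%N ->
  (forall t, `|t| < e -> hasD t (1 : R) h (h1 t)) -> CtOn e h1 ->
  forall t, `|t| < e -> hasD t (1 : R) (wmean e a h) (wmean e a.+1 h1 t).
Proof.
move=> a0 dh c1; have aR : a%:R != 0 :> R by rewrite pnatr_eq0 -lt0n.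
have ch := der_CtOn dh.
have cy : CtOn e (wmean e a.+1 h1) by exact: wmean_CtOn.
have [F0 dF] := primitiveP cy; set F := primitive _ _ in F0 dF.
pose W t := F t + h 0 / a%:R.
have dW t : `|t| < e -> hasD t (1 : R) W (wmean e a.+1 h1 t).
  by move=> te; apply: der_eq; [apply: derD; [exact: dF|exact: der_cst]|rewrite addr0].
have E t : `|t| < e -> t * wmean e a.+1 h1 t + a%:R * W t - h t = 0.
  move=> te; pose q s := s * wmean e a.+1 h1 s + a%:R * W s - h s.
  have q0 : q 0 = 0 by rewrite /q /W F0; field.
  rewrite -[LHS]/(q t) -q0; apply: (@cst_off0 _ e) => //.
    apply: (@CkOnB R 0) => //; apply: (@CkOnD R 0).
      by apply: (@CkOnM R 0) => //; exact: (@CkOn_id R 0).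
    by apply: (@CkOnZ R 0); exact: der_CtOn dW.
  move=> s se s0; apply: der_eq.
    apply: derB; last exact: dh.
    apply: derD; first by apply: derM; [exact: der_id|exact: wmean_der].
    by apply: derM; [exact: der_cst|exact: dW].
  by rewrite -natr1; field.
move=> t te; apply: (@hasD_ext _ e W) (dW t te) => //.
apply: wmean_unique => //; first exact: der_CtOn dW.
move=> s se s0; apply: der_eq (dW s se) _.
have -> : h s = s * wmean e a.+1 h1 s + a%:R * W s by apply/eqP; rewrite -subr_eq0 -opprB oppr_eq0 E.
by field.
Qed.

Lemma CkOn_wmean k e a h : (0 < a)%N -> CkOn k e h -> CkOn k e (wmean e a h).
Proof.
elim: k a h => [|k IH] a h a0; first exact: wmean_CtOn.
move=> [h1 [dh ch]]; exists (wmean e a.+1 h1); split; last exact: IH.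
by apply: wmean_derS => //; exact: CkOn_CtOn ch.
Qed.

Lemma CkOn_mul_wmean k e a h : (0 < a)%N -> CkOn k e h ->
  CkOn k.+1 e (fun t => t * wmean e a h t).
Proof. by move=> a0 ch; apply: wmean_gain => //; exact: CkOn_wmean. Qed.

End Average.

(** * The singular fixed-point problem *)

Section FixedPoint.
Context {R : realType}.
Implicit Types (e d s t M : R) (u v : R -> R).

(** Evenness belongs to the invariant set because the solution must be an even function of [t]. *)
Definition admissible M u :=
  [/\ continuous u, forall t, `|u t| <= M & forall t, u (- t) = u t].

Lemma half_pow_small M (eps : R) : 0 < eps -> exists k, M / 2 ^+ k < eps.
Proof.
move=> e0; exists (Num.bound (M / eps)).
rewrite ltr_pdivrMr ?exprn_gt0// mulrC -ltr_pdivrMr//.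
have [M0|M0] := leP 0 M; last first.
  by apply: (@lt_trans _ _ 0); rewrite ?exprn_gt0// pmulr_llt0 ?invr_gt0.
apply: lt_le_trans (archi_boundP _) _; first by rewrite divr_ge0// ltW.
by rewrite -natrX ler_nat ltnW// ltn_expl.
Qed.

(** Picard iteration from 0 with factor 1/2. The limit is obtained pointwise, as the infimum of
    decreasing upper envelopes of the iterates. *)
Lemma contraction_fixpoint M (Phi : (R -> R) -> R -> R) : 0 <= M ->
  (forall u, admissible M u -> admissible M (Phi u)) ->
  (forall u v (delta : R), admissible M u -> admissible M v ->
     (forall t, `|u t - v t| <= delta) -> forall t, `|Phi u t - Phi v t| <= delta / 2) ->
  exists2 u, admissible M u & forall t, u t = Phi u t.
Proof.
move=> M0 PM PC.
pose w k := iter k Phi (fun=> 0).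
have aw k : admissible M (w k).
  elim: k => [|k IH]; last exact: PM.
  by split=> // [t|t]; [exact: cvg_cst|rewrite normr0].
have step k t : `|w k.+1 t - w k t| <= M / 2 ^+ k.
  elim: k t => [|k IH] t.
    by rewrite subr0 expr0 divr1; have [_ + _] := aw 1%N; apply.
  by rewrite exprS [2 * _]mulrC invfM mulrA; apply: PC; [exact: (aw k.+1)|exact: aw|exact: IH].
(* [2 M / 2^k] is the sum of all step bounds [M / 2^j] with [j >= k]; this makes [up] decrease and
   [lo] increase with [k]. *)
pose up k t := w k t + 2 * M / 2 ^+ k.
pose lo k t := w k t - 2 * M / 2 ^+ k.
have pS k : 2 * M / 2 ^+ k = 2 * M / 2 ^+ k.+1 + M / 2 ^+ k.
  by rewrite exprS; field; rewrite expf_neq0.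
have upS k t : up k.+1 t <= up k t.
  by rewrite /up (pS k); have := step k t; rewrite ler_norml => /andP[? ?]; lra.
have loS k t : lo k t <= lo k.+1 t.
  by rewrite /lo (pS k); have := step k t; rewrite ler_norml => /andP[? ?]; lra.
have p0 k : 0 <= 2 * M / 2 ^+ k by rewrite !mulr_ge0// invr_ge0 exprn_ge0.
have lu k t : lo k t <= up k t.
  by rewrite /lo /up; have := p0 k; lra.
have upm t : {homo up ^~ t : i j / (i <= j)%N >-> j <= i}.
  by apply: homo_leq => [x|x y z yx zy|i]; [exact: lexx|exact: le_trans zy yx|exact: upS].
have lom t : {homo lo ^~ t : i j / (i <= j)%N >-> i <= j}.
  by apply: homo_leq => [x|x y z|i]; [exact: lexx|exact: le_trans|exact: loS].
have lup i j t : lo i t <= up j t.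
  apply: (le_trans (lom t i (maxn i j) (leq_maxl _ _))); apply: (le_trans (lu _ _)).
  exact: (upm t j (maxn i j) (leq_maxr _ _)).
pose u t := inf [set up k t | k in [set: nat]].
have hlb t i : lbound [set up k t | k in [set: nat]] (lo i t).
  by move=> _ [k _ <-]; exact: lup.
have u_up k t : u t <= up k t.
  by apply: ge_inf; [exists (lo 0 t); exact: hlb|exists k].
have u_lo k t : lo k t <= u t.
  by apply: lb_le_inf; [exists (up 0 t); exists 0%N|exact: hlb].
have uw k t : `|u t - w k t| <= 2 * M / 2 ^+ k.
  by have := u_up k t; have := u_lo k t; rewrite /up /lo ler_norml => ? ?; apply/andP; split; lra.
have au : admissible M u.
  split.
  - move=> t; apply/cvgrPdist_lt => /= eps e0.
    have e4 : 0 < eps / 4 by lra.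
    have [k kP] := half_pow_small (2 * M) e4.
    have [cw _ _] := aw k.
    have /cvgrPdist_lt/(_ _ e4) N := cw t.
    near=> s.
    have : `|w k t - w k s| < eps / 4 by near: s; exact: N.
    have := uw k t; have := uw k s; rewrite !ler_norml !ltr_norml => /andP[? ?] /andP[? ?] /andP[? ?].
    by apply/andP; split; lra.
  - move=> t; apply/ler_addgt0Pl => eps e0.
    have [k kP] := half_pow_small (2 * M) e0.
    have [_ bw _] := aw k.
    have := uw k t; have := bw t; rewrite !ler_norml => /andP[? ?] /andP[? ?].
    by apply/andP; split; lra.
  - move=> t; rewrite /u; congr (inf _); congr (_ @` _); apply/funext => k.
    by have [_ _ ev] := aw k; rewrite /up ev.
exists u => // t; apply/eqP; rewrite -subr_eq0 -normr_eq0.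
apply/eqP/le_anti; rewrite normr_ge0 andbT; apply/ler_addgt0Pl => eps e0; rewrite addr0.
have e4 : 0 < eps / 4 by lra.
have [k kP] := half_pow_small (2 * M) e4.
have h1 := uw k.+1 t; have h2 := PC _ _ _ au (aw k) (uw k) t.
have h0 := p0 k.+1.
have h3 : 0 <= M / 2 ^+ k by rewrite !mulr_ge0// invr_ge0 exprn_ge0.
have := pS k; move: h1 h2; rewrite /= -/(w k) !ler_norml => /andP[? ?] /andP[? ?] ?.
by apply/andP; split; lra.
Unshelve. all: by end_near. Qed.

Lemma locally_bounded e u : 0 < e -> CtOn e u ->
  exists2 d, 0 < d & forall t, `|t| <= d -> `|u t| <= `|u 0| + 1.
Proof.
move=> e0 cu; have : `|0 : R| < e by rewrite normr0.
move=> /cu /cvgrPdist_lt/(_ _ ltr01)/nbhs_ballP[d /= d0 D].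
exists (d / 2); first by lra.
move=> t td; have := D t; rewrite /ball/= sub0r normrN => /(_ ltac:(lra)) /ltW.
rewrite distrC => h; rewrite -[u t](subrK (u 0)); apply: le_trans (ler_normD _ _) _.
by rewrite addrC lerD2l.
Qed.

Lemma quadratic_bound (C M c0 c1 c2 c3 c4 x y : R) :
  `|c0| <= C -> `|c1| <= C -> `|c2| <= C -> `|c3| <= C -> `|c4| <= C ->
  `|x| <= M -> `|y| <= M ->
  `|c0 + c1 * x + c2 * x ^+ 2 + c3 * x * y + c4 * y ^+ 2| <= C * (1 + M + 3 * M ^+ 2).
Proof.
move=> h0 h1 h2 h3 h4 hx hy.
have C0 : 0 <= C by apply: le_trans h0.
have M0 : 0 <= M by apply: le_trans hx.
have -> : C * (1 + M + 3 * M ^+ 2) = C + C * M + C * (M * M) + C * M * M + C * (M * M) by ring.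
repeat (apply: le_trans (ler_normD _ _) _; apply: lerD); rewrite ?expr2 ?normrM//;
  by repeat (apply: ler_pM => //; rewrite ?mulr_ge0//).
Qed.

(** Each difference factors through [x - x'] or [y - y']; the two squares and the mixed term
    contribute [2 M] each, whence [6 M]. *)
Lemma quadratic_lipschitz (C M delta c0 c1 c2 c3 c4 x y x' y' : R) :
  `|c1| <= C -> `|c2| <= C -> `|c3| <= C -> `|c4| <= C ->
  `|x| <= M -> `|y| <= M -> `|x'| <= M -> `|y'| <= M ->
  `|x - x'| <= delta -> `|y - y'| <= delta ->
  `|(c0 + c1 * x + c2 * x ^+ 2 + c3 * x * y + c4 * y ^+ 2) -
    (c0 + c1 * x' + c2 * x' ^+ 2 + c3 * x' * y' + c4 * y' ^+ 2)|
  <= C * (1 + 6 * M) * delta.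
Proof.
move=> h1 h2 h3 h4 hx hy hx' hy' hdx hdy.
have C0 : 0 <= C by apply: le_trans h1.
have M0 : 0 <= M by apply: le_trans hx.
have D0 : 0 <= delta by apply: le_trans hdx.
have -> : (c0 + c1 * x + c2 * x ^+ 2 + c3 * x * y + c4 * y ^+ 2) -
    (c0 + c1 * x' + c2 * x' ^+ 2 + c3 * x' * y' + c4 * y' ^+ 2) =
  c1 * (x - x') + c2 * (x - x') * (x + x') + c3 * (x - x') * y + c3 * (y - y') * x'
  + c4 * (y - y') * (y + y') by ring.
have -> : C * (1 + 6 * M) * delta = C * delta + C * delta * (M + M) + C * delta * M +
  C * delta * M + C * delta * (M + M) by ring.
repeat (apply: le_trans (ler_normD _ _) _; apply: lerD); rewrite ?normrM//;
  repeat (apply: ler_pM => //; rewrite ?mulr_ge0//);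
  by apply: le_trans (ler_normD _ _) _; apply: lerD.
Qed.

(* With [z] the weighted mean of [u], the relation solved here is
   [t z' + N z = A + t^2 Q(t, z, t z')], where [Q] is quadratic in its last two arguments. *)
Lemma singular_fixpoint e (N : nat) (A c0 c1 c2 c3 c4 : R -> R) : 0 < e -> (0 < N)%N ->
  CtOn e A -> CtOn e c0 -> CtOn e c1 -> CtOn e c2 -> CtOn e c3 -> CtOn e c4 ->
  (forall t, `|t| < e -> [/\ A (- t) = A t, c0 (- t) = c0 t & c1 (- t) = c1 t]) ->
  (forall t, `|t| < e -> [/\ c2 (- t) = c2 t, c3 (- t) = c3 t & c4 (- t) = c4 t]) ->
  exists d u, [/\ 0 < d, d < e, continuous u, forall t, u (- t) = u t &
    forall t, `|t| <= d -> let z := wmean e N u t in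
      u t = A t + t ^+ 2 * (c0 t + c1 t * z + c2 t * z ^+ 2 + c3 t * z * u t + c4 t * u t ^+ 2)].
Proof.
move=> e0 N0 cA k0 k1 k2 k3 k4 ev1 ev2.
(* Near 0, [|A|] is at most [|A 0| + 1] and the [t^2] term will be at most 1/2, so the ball of
   radius [M] is invariant. *)
pose M := `|A 0| + 2.
pose C := `|c0 0| + `|c1 0| + `|c2 0| + `|c3 0| + `|c4 0| + 1.
have [n0 n1 n2] := And3 (normr_ge0 (c0 0)) (normr_ge0 (c1 0)) (normr_ge0 (c2 0)).
have [n3 n4] := (normr_ge0 (c3 0), normr_ge0 (c4 0)).
have M2 : 2 <= M by rewrite /M; have := normr_ge0 (A 0); lra.
have M0 : 0 <= M by lra.
have MM : 0 <= M ^+ 2 by rewrite exprn_ge0.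
have B0 : `|c0 0| + 1 <= C by rewrite /C; lra.
have B1 : `|c1 0| + 1 <= C by rewrite /C; lra.
have B2 : `|c2 0| + 1 <= C by rewrite /C; lra.
have B3 : `|c3 0| + 1 <= C by rewrite /C; lra.
have B4 : `|c4 0| + 1 <= C by rewrite /C; lra.
have C1 : 1 <= C by lra.
have C0 : 0 <= C by lra.
have Mb : 1 + M + 3 * M ^+ 2 <= 1 + 6 * M + 3 * M ^+ 2 by lra.
have Ml : 1 + 6 * M <= 1 + 6 * M + 3 * M ^+ 2 by lra.
have CK : 1 <= C * (1 + 6 * M + 3 * M ^+ 2) by rewrite -[1]mulr1 ler_pM//; lra.
(* [K / 2] dominates both the size and the Lipschitz constant of the quadratic term. Once
   [d <= 1/K <= 1], the factor [t^2 <= d] brings both down to 1/2. *)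
pose K := 2 * (C * (1 + 6 * M + 3 * M ^+ 2)).
have K1 : 1 <= K by rewrite /K; lra.
have K0 : 0 < K by lra.
have [dA dA0 bA] := locally_bounded e0 cA.
have [d0 d00 b0] := locally_bounded e0 k0.
have [d1 d10 b1] := locally_bounded e0 k1.
have [d2 d20 b2] := locally_bounded e0 k2.
have [d3 d30 b3] := locally_bounded e0 k3.
have [d4 d40 b4] := locally_bounded e0 k4.
pose d := Num.min (K^-1) (Num.min (e / 2) (Num.min dA (Num.min d0 (Num.min d1 (Num.min d2 (Num.min d3 d4)))))).
have dp : 0 < d by rewrite /d !lt_min invr_gt0 K0 dA0 d00 d10 d20 d30 d40 !andbT /=; lra.
have : d <= d by [].
rewrite {2}/d !le_min => /andP[dK /andP[de /andP[ddA /andP[dd0 /andP[dd1 /andP[dd2 /andP[dd3 dd4]]]]]]].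
have de' : d < e by apply: le_lt_trans de _; rewrite ltr_pdivrMr ?ltr0n// ltr_pMr ?ltr1n.
have dle t : `|clamp d t| <= d by apply: clamp_le; exact: ltW.
have dlt t : `|clamp d t| < e by apply: le_lt_trans de'.
have sq t : (clamp d t) ^+ 2 * (C * (1 + 6 * M + 3 * M ^+ 2)) <= 1 / 2.
  have h1 : (clamp d t) ^+ 2 <= d.
    rewrite -real_normK ?num_real//; have := dle t; have := normr_ge0 (clamp d t).
    move: (`|_|) => y y0 yd; have d1' : d <= 1.
      by apply: (le_trans dK); rewrite invf_le1.
    by rewrite expr2; apply: le_trans (ler_pM y0 y0 yd yd) _; rewrite ger_pMr.
  apply: (@le_trans _ _ (K^-1 * (C * (1 + 6 * M + 3 * M ^+ 2)))).
    by apply: ler_wpM2r; [exact: le_trans ler01 CK|exact: le_trans dK].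
  rewrite le_eqVlt; apply/orP; left; apply/eqP; rewrite /K.
  by move: CK; set X := C * _ => CK; field; rewrite gt_eqF// (lt_le_trans ltr01 CK).
have hC t : let s := clamp d t in [/\ `|c0 s| <= C, `|c1 s| <= C, `|c2 s| <= C, `|c3 s| <= C & `|c4 s| <= C].
  have l := dle t; split.
  - exact: le_trans (b0 _ (le_trans l dd0)) B0.
  - exact: le_trans (b1 _ (le_trans l dd1)) B1.
  - exact: le_trans (b2 _ (le_trans l dd2)) B2.
  - exact: le_trans (b3 _ (le_trans l dd3)) B3.
  - exact: le_trans (b4 _ (le_trans l dd4)) B4.
(* Clamping lets the operator act on functions on the whole line, while means and coefficients are
   evaluated only in [[-d, d]]. *)
pose Phi (u : R -> R) t := let s := clamp d t in let z := wmean e N u s in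
  A s + s ^+ 2 * (c0 s + c1 s * z + c2 s * z ^+ 2 + c3 s * z * u s + c4 s * u s ^+ 2).
have zM u t : admissible M u -> `|wmean e N u (clamp d t)| <= M.
  by case=> cu bu _; apply: wmean_bound => // s _; exact: cu.
have PhiP u : admissible M u -> admissible M (Phi u).
  move=> au; have [cu bu eu] := au; have cue : CtOn e u by move=> s _; exact: cu.
  split.
  - move=> t; rewrite /Phi; apply: (@continuous_comp _ _ _ (clamp d)
      (fun s => A s + s ^+ 2 * (c0 s + c1 s * wmean e N u s + c2 s * wmean e N u s ^+ 2
        + c3 s * wmean e N u s * u s + c4 s * u s ^+ 2))); first exact: clamp_cont.
    have cz := wmean_CtOn N0 cue.
    apply: (_ : CtOn e _) (dlt t).
    apply: (@CkOnD R 0) => //; apply: (@CkOnM R 0); first exact: (@CkOnX R 0 _ _ _ (@CkOn_id R 0 e)).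
    apply: (@CkOnD R 0); last by apply: (@CkOnM R 0) => //; exact: (@CkOnX R 0).
    apply: (@CkOnD R 0); last by apply: (@CkOnM R 0) => //; exact: (@CkOnM R 0).
    apply: (@CkOnD R 0); last by apply: (@CkOnM R 0) => //; exact: (@CkOnX R 0).
    by apply: (@CkOnD R 0) => //; exact: (@CkOnM R 0).
  - move=> t; rewrite /Phi /=; have [H0 H1 H2 H3 H4] := hC t.
    apply: le_trans (ler_normD _ _) _; rewrite normrM.
    have hA : `|A (clamp d t)| <= `|A 0| + 1 by apply: bA; exact: le_trans ddA.
    have Q := quadratic_bound H0 H1 H2 H3 H4 (zM u t au) (bu (clamp d t)).
    have : `|clamp d t ^+ 2| * `|c0 (clamp d t) + c1 (clamp d t) * wmean e N u (clamp d t) +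
      c2 (clamp d t) * wmean e N u (clamp d t) ^+ 2 +
      c3 (clamp d t) * wmean e N u (clamp d t) * u (clamp d t) +
      c4 (clamp d t) * u (clamp d t) ^+ 2| <= 1 / 2.
      rewrite ger0_norm ?sqr_ge0//; apply: le_trans (sq t); apply: ler_wpM2l; first exact: sqr_ge0.
      exact: le_trans Q (ler_wpM2l C0 Mb).
    move=> hy; apply: le_trans (lerD hA hy) _; rewrite /M -addrA lerD2l; clear; lra.
  - move=> t; rewrite /Phi clampN ?ltW//= sqrrN.
    have [E1 E2 E3] := ev1 _ (dlt t); have [E4 E5 E6] := ev2 _ (dlt t).
    by rewrite E1 E2 E3 E4 E5 E6 eu wmean_even.
have [|u au E] := @contraction_fixpoint M Phi M0 PhiP.
- move=> u v delta au av uv t; rewrite /Phi /=.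
  have [cu bu _] := au; have [cv bv _] := av.
  have cue : CtOn e u by move=> s _; exact: cu.
  have cve : CtOn e v by move=> s _; exact: cv.
  have [H0 H1 H2 H3 H4] := hC t.
  have hz : `|wmean e N u (clamp d t) - wmean e N v (clamp d t)| <= delta.
    rewrite -wmeanB//; apply: wmean_bound => //.
    exact: (@CkOnB R 0).
  have Q := quadratic_lipschitz (c0 (clamp d t)) H1 H2 H3 H4 (zM u t au) (bu (clamp d t)) (zM v t av) (bv (clamp d t)) hz (uv (clamp d t)).
  rewrite opprD addrACA subrr add0r -mulrBr normrM ger0_norm ?sqr_ge0//.
  apply: le_trans (ler_wpM2l (sqr_ge0 _) Q) _.
  have delta0 : 0 <= delta by apply: le_trans hz.
  apply: (@le_trans _ _ ((clamp d t) ^+ 2 * (C * (1 + 6 * M + 3 * M ^+ 2)) * delta)).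
    rewrite -[leRHS]mulrA; apply: ler_wpM2l; first exact: sqr_ge0.
    exact: ler_wpM2r delta0 _ _ (ler_wpM2l C0 Ml).
  by rewrite mulrC; apply: ler_wpM2l => //; have := sq t; rewrite div1r.
have [cu _ eu] := au.
by exists d, u; split=> // t td /=; rewrite [LHS]E /Phi /= clamp_id.
Qed.

End FixedPoint.

(** * The reduced radial equation: existence of a smooth even solution *)

Section RadialOde.
Context {R : realType}.
Implicit Types (e d s t : R) (f g h : R -> R).

Definition evenOn e f := forall t, `|t| < e -> f (- t) = f t.

Lemma CtOn_global e f : continuous f -> CtOn e f.
Proof. by move=> cf t _; exact: cf. Qed.

Lemma CtOn_pos e f : 0 < e -> CtOn e f -> 0 < f 0 ->
  exists d, [/\ 0 < d, d <= e & forall t, `|t| < d -> 0 < f t].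
Proof.
move=> e0 cf f0; have : `|0 : R| < e by rewrite normr0.
move=> /cf /cvgrPdist_lt/(_ _ f0)/nbhs_ballP[d /= d0 D].
exists (Num.min d e); split; rewrite ?lt_min ?d0 ?ge_min ?lexx ?orbT//.
move=> t; rewrite lt_min => /andP[td _]; have := D t.
rewrite /ball/= sub0r normrN => /(_ td); rewrite ltr_norml => /andP[_ ?]; lra.
Qed.

Variables (n : nat) (c e : R) (a b : R -> R).
Hypothesis e0 : 0 < e.
Hypotheses (sa : smoothOn e a) (sb : smoothOn e b).
Hypotheses (ea : evenOn e a) (eb : evenOn e b).

(** With [Y = 1 + t^2 Z] the reduced equation is [Y^2 = (1 + t^2 a) (1 + t^2 S z)]. Cancelling 1 and
    dividing by [t^2] gives [2 Z + t^2 Z^2 = Rh z], and separating the terms of order [t^2] gives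
    [2 Z + m z = A + t^2 B z Z]. The constant [ka] comes from the term [p^2]. *)
Let m : R := n%:R - 2.
Let ka : R := m * c / (4 * (n%:R - 1)).
Let A t := a t + (n%:R - 1) * b t + ka.
Let S z t := (n%:R - 1) * b t - m * z t + ka * (1 + t ^+ 2 * z t) ^+ 2.
Let Rh z t := a t + (1 + t ^+ 2 * a t) * S z t.
Let B z Z t := - Z t ^+ 2 + a t * S z t + ka * (2 * z t + t ^+ 2 * z t ^+ 2).

Let CkS k d z : d <= e -> CkOn k d z -> CkOn k d (S z).
Proof.
move=> de cz; apply: CkOnD.
  by apply: CkOnB; apply: CkOnZ => //; exact: CkOn_sub de (sb k).
apply: CkOnZ; apply: CkOnX; apply: CkOnD; first exact: CkOn_cst.
by apply: CkOnM => //; apply: CkOnX; exact: CkOn_id.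
Qed.

Let Ckta k d : d <= e -> CkOn k d (fun t => 1 + t ^+ 2 * a t).
Proof.
move=> de; apply: CkOnD; first exact: CkOn_cst.
by apply: CkOnM; [apply: CkOnX; exact: CkOn_id|exact: CkOn_sub de (sa k)].
Qed.

Let CkR k d z : d <= e -> CkOn k d z -> CkOn k d (Rh z).
Proof.
move=> de cz; apply: CkOnD; first exact: CkOn_sub de (sa k).
by apply: CkOnM; [exact: Ckta|exact: CkS].
Qed.

Let CkB k d z Z : d <= e -> CkOn k d z -> CkOn k d Z -> CkOn k d (B z Z).
Proof.
move=> de cz cZ; apply: CkOnD; last first.
  apply: CkOnZ; apply: CkOnD; first exact: CkOnZ.
  by apply: CkOnM; [apply: CkOnX; exact: CkOn_id|exact: CkOnX].
apply: CkOnD; first by apply: CkOnN; exact: CkOnX.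
by apply: CkOnM; [exact: CkOn_sub de (sa k)|exact: CkS].
Qed.

(* [2 Z + t^2 Z^2 = Rh z] determines [Z] from [z] through a square root. *)
Let CkZ k d z Z : d <= e -> (forall t, `|t| < d -> 0 < 1 + t ^+ 2 * Z t) ->
  (forall t, `|t| < d -> 2 * Z t + t ^+ 2 * Z t ^+ 2 = Rh z t) ->
  CkOn k d z -> CkOn k d Z.
Proof.
move=> de pos rel cz; have cR := CkR de cz.
have cY2 : CkOn k d (fun t => 1 + t ^+ 2 * Rh z t).
  apply: CkOnD; first exact: CkOn_cst.
  by apply: CkOnM => //; apply: CkOnX; exact: CkOn_id.
have E t : `|t| < d -> 1 + t ^+ 2 * Rh z t = (1 + t ^+ 2 * Z t) ^+ 2.
  by move=> td; rewrite -rel//; ring.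
have cY : CkOn k d (fun t => 1 + t ^+ 2 * Z t).
  apply: CkOn_ext (CkOn_sqrt _ cY2) => t td; rewrite E//.
    by rewrite sqrtr_sqr gtr0_norm// pos.
  by rewrite exprn_gt0// pos.
(* Recovering [Z] as [(Y - 1) / t^2] would lose regularity at 0; instead [Rh z = Z (1 + Y)], and
   [1 + Y] is positive. *)
apply: (@CkOn_ext _ _ _ (fun t => Rh z t * (1 + (1 + t ^+ 2 * Z t))^-1)).
  move=> t td; have p := pos t td; rewrite -rel//; field.
  by rewrite gt_eqF//; lra.
apply: CkOnM => //; apply: CkOnV; first by move=> t /pos p; rewrite gt_eqF//; lra.
by apply: CkOnD => //; exact: CkOn_cst.
Qed.

(** [Z] stands for [2 z + t z' / 2], chosen so that [p = C t^2 (1 + t^2 z)] has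
    [p' / t = 2 C (1 + t^2 Z)]. Treating it as a second function keeps the algebraic relation
    meaningful at 0. *)
Lemma radial_ode : exists d (z Z : R -> R),
  [/\ 0 < d, d <= e, smoothOn d z & smoothOn d Z] /\
  [/\ evenOn d z, evenOn d Z,
    forall t, `|t| < d -> 0 < 1 + t ^+ 2 * Z t,
    forall t, `|t| < d -> t != 0 -> hasD t (1 : R) z ((2 * Z t - 4 * z t) / t) &
    forall t, `|t| < d -> 2 * Z t + t ^+ 2 * Z t ^+ 2 =
      a t + (1 + t ^+ 2 * a t) * ((n%:R - 1) * b t - (n%:R - 2) * z t +
        (n%:R - 2) * c / (4 * (n%:R - 1)) * (1 + t ^+ 2 * z t) ^+ 2)].
Proof.
(* Adding [(n-2) z] to [2 Z = t z' + 4 z] gives [u = t z' + (n+2) z], so [z] is the mean of [u] with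
   weight [n + 2]. *)
pose N := (n + 2)%N.
have N0 : (0 < N)%N by rewrite /N addn2.
have NR : N%:R = n%:R + 2 :> R by rewrite natrD.
have cA : CtOn e A.
  apply: (@CkOnD R 0); last exact: CkOn_cst.
  by apply: (@CkOnD R 0); [exact: (sa 0)|apply: (@CkOnZ R 0); exact: (sb 0)].
have ct2 k : CkOn k e (fun t => t ^+ 2) by apply: CkOnX; exact: CkOn_id.
(* These are the coefficients of [B] after substituting [Z = (u - m z) / 2]; expanding [- Z^2]
   produces [- m^2 / 4], [m / 2] and [- 1 / 4]. *)
pose c0 t := a t * (n%:R - 1) * b t + a t * ka.
pose c1 t := - m * a t + 2 * ka * (a t * t ^+ 2) + 2 * ka.
pose c2 t := - m ^+ 2 / 4 + ka * (a t * (t ^+ 2) ^+ 2) + ka * t ^+ 2.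
have k0 : CtOn e c0.
  apply: (@CkOnD R 0); last by apply: (@CkOnM R 0); [exact: (sa 0)|exact: CkOn_cst].
  apply: (@CkOnM R 0); last exact: (sb 0).
  by apply: (@CkOnM R 0); [exact: (sa 0)|exact: CkOn_cst].
have k1 : CtOn e c1.
  apply: (@CkOnD R 0); last exact: CkOn_cst.
  apply: (@CkOnD R 0); first by apply: (@CkOnZ R 0); exact: (sa 0).
  apply: (@CkOnZ R 0); apply: (@CkOnM R 0); [exact: (sa 0)|exact: (ct2 0)].
have k2 : CtOn e c2.
  apply: (@CkOnD R 0); last by apply: (@CkOnZ R 0); exact: (ct2 0).
  apply: (@CkOnD R 0); first exact: CkOn_cst.
  apply: (@CkOnZ R 0); apply: (@CkOnM R 0); first exact: (sa 0).
  by apply: (@CkOnX R 0); exact: (ct2 0).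
have k3 : CtOn e (fun=> m / 2) by exact: (@CkOn_cst R 0).
have k4 : CtOn e (fun=> - (4^-1)) by exact: (@CkOn_cst R 0).
have [||d [u [d0 de cu eu E]]] := singular_fixpoint e0 N0 cA k0 k1 k2 k3 k4.
- by move=> t te; rewrite /A /c0 /c1 ea// eb// sqrrN.
- by move=> t te; rewrite /c2 ea// sqrrN.
pose z := wmean e N u; pose Z t := (u t - m * z t) / 2.
have cue : CtOn e u by exact: CtOn_global.
have cz : CtOn e z by exact: wmean_CtOn.
have cZ : CtOn e Z.
  apply: (@CkOnM R 0); last exact: CkOn_cst.
  by apply: (@CkOnB R 0) => //; exact: (@CkOnZ R 0).
have [d' [d'0 d'd pos]] : exists d', [/\ 0 < d', d' <= d & forall t, `|t| < d' -> 0 < 1 + t ^+ 2 * Z t].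
  apply: CtOn_pos => //; last by rewrite expr0n mul0r addr0.
  apply: (@CkOnD R 0); first exact: CkOn_cst.
  apply: (@CkOnM R 0); first by apply: (@CkOnX R 0); exact: (@CkOn_id R 0).
  exact: (@CkOn_sub R 0 _ _ _ (ltW de) cZ).
have d'e : d' <= e by apply: le_trans d'd (ltW de).
have lt_e t : `|t| < d' -> `|t| < e by move=> h; exact: lt_le_trans d'e.
have uE t : u t = 2 * Z t + m * z t by rewrite /Z; field.
have E' t : `|t| < d' -> u t = A t + t ^+ 2 * B z Z t.
  move=> td; have := E t (le_trans (ltW td) d'd) => /= ->; congr (_ + _ * _).
  by rewrite -/(z t) /B /Z /S /c0 /c1 /c2; field.
have rel t : `|t| < d' -> 2 * Z t + t ^+ 2 * Z t ^+ 2 = Rh z t.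
  by move=> td; have := E' t td; rewrite uE /A /B /Rh /S => h; lra.
have dz t : `|t| < d' -> t != 0 -> hasD t (1 : R) z ((u t - N%:R * z t) / t).
  by move=> td t0; apply: wmean_der => //; exact: lt_e.
(* The mean of weight [N] of [s^2 B] equals [t] times the mean of weight [N+1] of [s B]; that outer
   [t] is what gains a derivative. *)
have zE k : CkOn k d' (B z Z) -> forall t, `|t| < d' ->
    wmean d' N A t + t * wmean d' N.+1 (fun s => s * B z Z s) t = z t.
  move=> cB' t td; have cA' : CtOn d' A by exact: (@CkOn_sub R 0 _ _ _ d'e cA).
  have ctB : CtOn d' (fun s => s * B z Z s).
    by apply: (@CkOnM R 0); [exact: (@CkOn_id R 0)|exact: CkOn_CtOn cB'].
  have cud : CtOn d' u by exact: (@CkOn_sub R 0 _ _ _ d'e cue).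
  rewrite [RHS](@wmean_unique R d' N N0 u z)//; last exact: (@CkOn_sub R 0 _ _ _ d'e cz).
  apply: (@wmean_unique R d' N N0 u (fun t => wmean d' N A t + t * wmean d' N.+1 (fun s => s * B z Z s) t)) => //.
    apply: (@CkOnD R 0); first exact: wmean_CtOn.
    by apply: (@CkOnM R 0); [exact: (@CkOn_id R 0)|exact: wmean_CtOn].
  move=> s sd s0; apply: der_eq.
    apply: derD; first exact: wmean_der.
    by apply: derM; [exact: der_id|exact: wmean_der].
  by rewrite E'// -natr1 /=; field.
(* Bootstrap: if [z] is of class [k], so are [Z] and [B], and [zE] then puts [z] in class [k+1]. *)
have sz k : CkOn k d' z.
  elim: k => [|k IH]; first exact: (@CkOn_sub R 0 _ _ _ d'e cz).
  have cB := CkB d'e IH (CkZ d'e pos rel IH).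
  apply: CkOn_ext (zE _ cB) _; apply: CkOnD.
    apply: CkOn_wmean => //; apply: CkOn_sub d'e _.
    apply: CkOnD; last exact: CkOn_cst.
    by apply: CkOnD; [exact: sa|apply: CkOnZ; exact: sb].
  by apply: CkOn_mul_wmean => //; apply: CkOnM => //; exact: CkOn_id.
have ez : evenOn d' z by move=> t td; apply: wmean_even => //; exact: lt_e.
exists d', z, Z; split; split=> //.
- by move=> k; exact: CkZ (sz k).
- by move=> t td; rewrite /Z eu ez.
- by move=> t td t0; apply: der_eq (dz t td t0) _; rewrite uE NR /m; field.
Qed.

End RadialOde.

(** * Ricci curvature of a radial metric in Cartesian coordinates *)

Section RicciRadial.
Context {R : realType} {n : nat}.
Implicit Types (x y : 'rV[R]_n) (f g : 'rV[R]_n -> R) (i j k l p : 'I_n).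

Let kr i j : R := (i == j)%:R.

Definition sqnorm x : R := \sum_(i < n) x 0 i ^+ 2.

Lemma krC i j : kr i j = kr j i. Proof. by rewrite /kr eq_sym. Qed.

Lemma krii i : kr i i = 1. Proof. by rewrite /kr eqxx. Qed.

Lemma sum_kr (F : 'I_n -> R) p : \sum_m kr p m * F m = F p.
Proof.
rewrite (bigD1 p)//= krii mul1r big1 ?addr0// => m /negbTE mp.
by rewrite /kr eq_sym mp mul0r.
Qed.

(** Rows of Christoffel symbols of a radial metric are combinations of two Kronecker deltas and [x],
    so this one identity evaluates all the index contractions. *)
Lemma sum_contract x p q u w (b0 b1 b2 d0 d1 d2 : R) :
  \sum_m (b0 * kr p m + b1 * kr q m + b2 * x 0 m) * (d0 * kr u m + d1 * kr w m + d2 * x 0 m) =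
  b0 * d0 * kr p u + b0 * d1 * kr p w + b0 * d2 * x 0 p +
  b1 * d0 * kr q u + b1 * d1 * kr q w + b1 * d2 * x 0 q +
  b2 * d0 * x 0 u + b2 * d1 * x 0 w + b2 * d2 * sqnorm x.
Proof.
transitivity (\sum_m (kr p m * (b0 * (d0 * kr u m + d1 * kr w m + d2 * x 0 m)) +
   kr q m * (b1 * (d0 * kr u m + d1 * kr w m + d2 * x 0 m)) +
   kr u m * (b2 * d0 * x 0 m) + kr w m * (b2 * d1 * x 0 m) + b2 * d2 * x 0 m ^+ 2)).
  by apply: eq_bigr => m _; ring.
rewrite !big_split/= !sum_kr -mulr_sumr -/(sqnorm x).
rewrite (krC u p) (krC w p) (krC u q) (krC w q); ring.
Qed.

Lemma sum_trace x j k (e0 e1 e2 e3 e4 : R) :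
  \sum_i (e0 + e1 * (kr j i * x 0 i) + e2 * (kr k i * x 0 i) + e3 * (kr j i * kr k i) + e4 * x 0 i ^+ 2) =
  n%:R * e0 + e1 * x 0 j + e2 * x 0 k + e3 * kr j k + e4 * sqnorm x.
Proof.
rewrite !big_split/= -!mulr_sumr !sum_kr -/(sqnorm x) sumr_const card_ord (krC k j).
by rewrite mulr_natl.
Qed.

Lemma der_coord x i j : hasD x (delta_mx 0 i) (fun y => y 0 j) (kr i j).
Proof.
apply/der_line; rewrite /kr.
apply: (@der_near _ _ (fun h : R => h * (i == j)%:R + x 0 j)).
  by near=> h; rewrite !mxE eqxx/= eq_sym.
apply: der_eq.
  by apply: derD; [apply: derM; [exact: der_id|exact: der_cst]|exact: der_cst].
by rewrite /=; ring.
Unshelve. all: by end_near. Qed.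

(* In a radial situation this reads [f' = t f1], that is [f1 = f' / t]. *)
Definition radD (U : set 'rV[R]_n) f f1 :=
  forall x, U x -> forall i, hasD x (delta_mx 0 i) f (x 0 i * f1 x).

Section RadD.
Variable U : set 'rV[R]_n.

Lemma radD_eq f f1 f2 : radD U f f1 -> (forall x, U x -> f1 x = f2 x) -> radD U f f2.
Proof. by move=> df E x Ux i; rewrite -E//; exact: df. Qed.

Lemma radD_cst (c : R) : radD U (fun=> c) (fun=> 0).
Proof. by move=> x _ i; rewrite mulr0; exact: der_cst. Qed.

Lemma radDD f g f1 g1 : radD U f f1 -> radD U g g1 ->
  radD U (fun x => f x + g x) (fun x => f1 x + g1 x).
Proof. by move=> df dg x Ux i; rewrite mulrDr; apply: derD; [exact: df|exact: dg]. Qed.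

Lemma radDB f g f1 g1 : radD U f f1 -> radD U g g1 ->
  radD U (fun x => f x - g x) (fun x => f1 x - g1 x).
Proof. by move=> df dg x Ux i; rewrite mulrBr; apply: derB; [exact: df|exact: dg]. Qed.

Lemma radDM f g f1 g1 : radD U f f1 -> radD U g g1 ->
  radD U (fun x => f x * g x) (fun x => f1 x * g x + f x * g1 x).
Proof.
move=> df dg x Ux i; apply: der_eq; first by apply: derM; [exact: df|exact: dg].
by ring.
Qed.

Lemma radDV f f1 : (forall x, U x -> f x != 0) -> radD U f f1 ->
  radD U (fun x => (f x)^-1) (fun x => - f1 x / f x ^+ 2).
Proof.
move=> f0 df x Ux i; apply: der_eq; first by apply: derV; [exact: f0|exact: df].
by have := f0 x Ux; set y := f x => y0; field.
Qed.

Lemma radD_sqnorm : radD U sqnorm (fun=> 2).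
Proof.
move=> x _ i.
have -> : sqnorm = \sum_(j < n) (fun y => y 0 j ^+ 2).
  by apply/funext => y; rewrite fct_sumE.
have -> : x 0 i * 2 = \sum_(j < n) kr i j * (2 * x 0 j) by rewrite sum_kr mulrC.
apply: is_derive_sum => j; apply: der_eq; first by apply: derX; exact: der_coord.
by rewrite /= expr1; ring.
Qed.

End RadD.

Lemma partial_near (U : set 'rV[R]_n) f g i x a : open U -> U x ->
  (forall y, U y -> g y = f y) -> hasD x (delta_mx 0 i) f a -> partial i g x = a.
Proof.
move=> oU Ux E df; apply: der_val; apply: der_near df.
by apply: filterS (open_nbhs_nbhs (conj oU Ux)) => y /E.
Qed.

(** The Sherman-Morrison formula, checked by multiplying out. *)
Lemma invmx_radial x (A q : R) (G : 'M[R]_n) :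
  A != 0 -> 1 + sqnorm x * q != 0 ->
  (forall i j, G i j = A * (kr i j + q * x 0 i * x 0 j)) ->
  forall i j, invmx G i j = A^-1 * (kr i j - q / (1 + sqnorm x * q) * x 0 i * x 0 j).
Proof.
move=> A0 H0 GE; set H := 1 + _ in H0 *.
pose K : 'M[R]_n := \matrix_(i, j) (A^-1 * (kr i j - q / H * x 0 i * x 0 j)).
suff GK : G *m K = 1%:M.
  have [uG _] := mulmx1_unit GK.
  by move=> i j; rewrite -[invmx G]mulmx1 -GK mulKmx// mxE.
apply/matrixP => i j; rewrite !mxE.
transitivity (\sum_m (1 * kr i m + 0 * kr i m + (q * x 0 i) * x 0 m) *
   (1 * kr j m + 0 * kr j m + (- (q / H * x 0 j)) * x 0 m)).
  by apply: eq_bigr => m _; rewrite GE mxE (krC m j); field; rewrite A0 H0.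
rewrite sum_contract -/(kr i j); move: H0; rewrite /H => H0.
by field.
Qed.

Section Christoffel.
Variables (U : set 'rV[R]_n) (G : 'rV[R]_n -> 'M[R]_n) (A q be q1 : 'rV[R]_n -> R).
Hypotheses (oU : open U).
Hypothesis GE : forall x, U x -> forall i j, G x i j = A x * (kr i j + q x * x 0 i * x 0 j).
Hypotheses (dA : radD U A (fun x => 2 * A x * be x)) (dq : radD U q q1).
Let H x := 1 + sqnorm x * q x.
Hypotheses (A0 : forall x, U x -> A x != 0) (H0 : forall x, U x -> H x != 0).

(** The division by [1 + |x|^2 q] comes from raising the index with the inverse metric; [be] is the
    logarithmic derivative of [A] over [2 t]. *)
Definition chr_al x := (q x - be x) / (1 + sqnorm x * q x).
Definition chr_ga x := (q1 x / 2 - be x * q x) / (1 + sqnorm x * q x).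

Lemma partial_radial_metric x p i j : U x -> partial p (fun y => G y i j) x =
  A x * (2 * be x * x 0 p * (kr i j + q x * x 0 i * x 0 j) + x 0 p * q1 x * x 0 i * x 0 j
    + q x * (kr p i * x 0 j + kr p j * x 0 i)).
Proof.
move=> Ux; apply: (partial_near oU Ux (fun y Uy => GE Uy i j)).
apply: der_eq.
  apply: derM; first exact: dA.
  apply: derD; first exact: der_cst.
  by apply: derM; [apply: derM; [exact: dq|exact: der_coord]|exact: der_coord].
by rewrite /=; ring.
Qed.

Lemma christoffel_radial x k i j : U x -> christoffel G k i j x =
  chr_al x * x 0 k * kr i j + be x * (x 0 i * kr j k + x 0 j * kr i k)
  + chr_ga x * x 0 i * x 0 j * x 0 k.
Proof.
move=> Ux; rewrite /christoffel /chr_al /chr_ga; have h0 := H0 Ux; have a0 := A0 Ux.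
rewrite /H in h0.
transitivity (2^-1 * \sum_m
  (1 * kr k m + 0 * kr k m + (- (q x / (1 + sqnorm x * q x) * x 0 k)) * x 0 m) *
  (2 * be x * x 0 i * kr j m + 2 * be x * x 0 j * kr i m +
   (2 * (q x - be x) * kr i j + (2 * be x * q x + q1 x) * x 0 i * x 0 j) * x 0 m)).
  congr (_ * _); apply: eq_bigr => m _.
  rewrite (invmx_radial a0 h0 (GE Ux)) !partial_radial_metric//.
  by rewrite (krC j i) (krC m i) (krC m j); field; rewrite h0 a0.
rewrite sum_contract (krC k j) (krC k i).
by field; rewrite h0.
Qed.

End Christoffel.

Section RicciOfChristoffel.
Variables (U : set 'rV[R]_n) (G : 'rV[R]_n -> 'M[R]_n).
Variables (al be ga al1 be1 ga1 : 'rV[R]_n -> R).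
Hypotheses (oU : open U).
Hypothesis GE : forall x, U x -> forall k i j, christoffel G k i j x =
  al x * x 0 k * kr i j + be x * (x 0 i * kr j k + x 0 j * kr i k)
  + ga x * x 0 i * x 0 j * x 0 k.
Hypotheses (dal : radD U al al1) (dbe : radD U be be1) (dga : radD U ga ga1).

Lemma partial_christoffel x p k i j : U x -> partial p (christoffel G k i j) x =
  x 0 p * al1 x * x 0 k * kr i j + al x * kr p k * kr i j
  + x 0 p * be1 x * (x 0 i * kr j k + x 0 j * kr i k)
  + be x * (kr p i * kr j k + kr p j * kr i k)
  + x 0 p * ga1 x * x 0 i * x 0 j * x 0 k
  + ga x * (kr p i * x 0 j * x 0 k + x 0 i * kr p j * x 0 k + x 0 i * x 0 j * kr p k).
Proof.
move=> Ux; apply: (partial_near oU Ux (fun y Uy => GE Uy k i j)).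
apply: der_eq.
  apply: derD.
    apply: derD.
      by apply: derM; [apply: derM; [exact: dal|exact: der_coord]|exact: der_cst].
    apply: derM; first exact: dbe.
    by apply: derD; apply: derM; first [exact: der_coord|exact: der_cst].
  apply: derM; last exact: der_coord.
  apply: derM; last exact: der_coord.
  by apply: derM; [exact: dga|exact: der_coord].
by rewrite /=; ring.
Qed.

(** [mu] is the trace of the connection: summing [Gamma^i_ij] over [i] gives [mu x_j]. *)
Lemma Ric_christoffel_radial x j k : U x ->
  let s := sqnorm x in
  let mu := al x + (n%:R + 1) * be x + ga x * s in
  Ric G x j k =
  (al1 x * s + n%:R * al x + 2 * be x - mu + mu * al x * s - 2 * al x * be x * s) * kr j k +
  (2 * be1 x + ga1 x * s + (n%:R + 2) * ga x
   - (al1 x + (n%:R + 1) * be1 x + ga1 x * s + 2 * ga x)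
   + mu * (2 * be x + ga x * s)
   - (al x ^+ 2 + 2 * al x * be x + (n%:R + 3) * be x ^+ 2 + 2 * al x * ga x * s
      + 4 * be x * ga x * s + ga x ^+ 2 * s ^+ 2)) * x 0 j * x 0 k.
Proof.
move=> Ux s mu; rewrite mxE.
(* The diagonal curvature term, sorted by its dependence on [i] into the five patterns summed by
   [sum_trace]. *)
transitivity (\sum_i (
  (al x * kr j k + ga x * x 0 j * x 0 k - x 0 j * be1 x * x 0 k - be x * kr j k
   + be x * x 0 j * be x * x 0 k + be x * x 0 k * be x * x 0 j
   + be x * (al x * kr j k + ga x * x 0 j * x 0 k) * s - be x ^+ 2 * x 0 j * x 0 k)
  + (x 0 k * be1 x + ga x * x 0 k - 2 * ga x * x 0 k 
     + (al x + be x) * be x * x 0 k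
     - al x * be x * x 0 k - be x * be x * x 0 k - be x * be x * x 0 k
     - be x * ga x * x 0 k * s) * (kr j i * x 0 i)
  + (x 0 j * be1 x + ga x * x 0 j - x 0 j * al1 x - x 0 j * be1 x
     + (al x + be x) * be x * x 0 j
     - al x * al x * x 0 j - be x * be x * x 0 j - be x * al x * x 0 j
     - ga x * al x * x 0 j * s) * (kr k i * x 0 i)
  + (be x + be x - al x - be x - be x * al x * s) * (kr j i * kr k i)
  + (al1 x * kr j k + ga1 x * x 0 j * x 0 k - x 0 j * ga1 x * x 0 k - ga x * kr j k
     + (al x + be x) * (al x * kr j k + ga x * x 0 j * x 0 k)
     + ga x * be x * x 0 j * x 0 k + ga x * be x * x 0 j * x 0 k
     + ga x * (al x * kr j k + ga x * x 0 j * x 0 k) * s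
     - al x * be x * kr j k - al x * ga x * x 0 j * x 0 k
     - be x * ga x * x 0 j * x 0 k
     - ga x * be x * x 0 j * x 0 k - ga x * be x * x 0 j * x 0 k
     - ga x * ga x * x 0 j * x 0 k * s) * x 0 i ^+ 2)).
  apply: eq_bigr => i _; rewrite /curvature big_split/= sumrN !partial_christoffel//.
  have -> : \sum_m christoffel G i i m x * christoffel G m j k x = \sum_m
    ((al x + be x) * x 0 i * kr i m + 0 * kr i m + (be x + ga x * x 0 i ^+ 2) * x 0 m) *
    (be x * x 0 j * kr k m + be x * x 0 k * kr j m + (al x * kr j k + ga x * x 0 j * x 0 k) * x 0 m).
    by apply: eq_bigr => m _; rewrite !GE// krii (krC m i); ring.
  have -> : \sum_m christoffel G i j m x * christoffel G m i k x = \sum_m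
    (al x * x 0 i * kr j m + be x * x 0 j * kr i m + (be x * kr j i + ga x * x 0 i * x 0 j) * x 0 m) *
    (be x * x 0 i * kr k m + be x * x 0 k * kr i m + (al x * kr k i + ga x * x 0 i * x 0 k) * x 0 m).
    by apply: eq_bigr => m _; rewrite !GE// (krC m i) (krC i k); ring.
  rewrite !sum_contract -/s !krii (krC i j) (krC i k); ring.
rewrite sum_trace -/s /mu; ring.
Qed.

End RicciOfChristoffel.

Section RicciRadialMetric.
Variables (U : set 'rV[R]_n) (G : 'rV[R]_n -> 'M[R]_n).
Variables (A k v k1 v1 k2 : 'rV[R]_n -> R).
Let h x := 1 + sqnorm x * k x.
Hypotheses (oU : open U).
Hypothesis GE : forall x, U x -> forall i j,
  G x i j = A x * (kr i j + (2 * k x + sqnorm x * k x ^+ 2) * x 0 i * x 0 j).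
Hypothesis dA : radD U A (fun x => 2 * A x * (v x * h x + k x)).
Hypotheses (dk : radD U k k1) (dv : radD U v v1) (dk1 : radD U k1 k2).
Hypotheses (A0 : forall x, U x -> A x != 0) (h0 : forall x, U x -> h x != 0).

(** [P] is the tangential component of the Ricci tensor and [P + |x|^2 Q] the radial one. As
    [2 v + |x|^2 v1] is [y = p' / t], these are the two equations of the overview, here without
    division by [t] and hence valid at the origin too. *)
Lemma Ric_radial_metric x : U x ->
  exists P Q : R, [/\ forall i j, Ric G x i j = P * kr i j + Q * x 0 i * x 0 j,
    P = - ((2 * v x + sqnorm x * v1 x) / h x +
           (n%:R - 2) * (2 * v x + sqnorm x * v x ^+ 2)) &
    P + sqnorm x * Q = - (n%:R - 1) * (2 * v x + sqnorm x * v1 x) * h x].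
Proof.
move=> Ux.
pose q x := 2 * k x + sqnorm x * k x ^+ 2.
have dh : radD U h (fun x => 2 * k x + sqnorm x * k1 x).
  apply: radD_eq; first by apply: radDD; [exact: radD_cst|apply: radDM; [exact: radD_sqnorm|exact: dk]].
  by move=> y _; rewrite /= add0r.
have dq : radD U q (fun x => 2 * k1 x + 2 * k x ^+ 2 + 2 * sqnorm x * k x * k1 x).
  have -> : q = fun x => 2 * k x + sqnorm x * (k x * k x) by apply/funext => y; rewrite /q expr2.
  apply: radD_eq.
    apply: radDD; first by apply: radDM; [exact: radD_cst|exact: dk].
    by apply: radDM; [exact: radD_sqnorm|apply: radDM; exact: dk].
  by move=> y _; rewrite /=; ring.
set q1 := (fun x => _) in dq.
have Hh y : 1 + sqnorm y * q y = h y ^+ 2 by rewrite /q /h; ring.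
have H0 y : U y -> 1 + sqnorm y * q y != 0 by move=> Uy; rewrite Hh expf_neq0// h0.
pose be x := v x * h x + k x.
have C := christoffel_radial oU GE dA dq A0 H0.
have dbe : radD U be (fun x => v1 x * h x + v x * (2 * k x + sqnorm x * k1 x) + k1 x).
  by apply: radDD => //; exact: radDM.
pose al x := (k x - v x) / h x.
pose ga x := (k1 x * h x + k x ^+ 2 - be x * (k x * (1 + h x))) / (h x * h x).
have dal : radD U al (fun x => (k1 x - v1 x) / h x - (k x - v x) * (2 * k x + sqnorm x * k1 x) / h x ^+ 2).
  apply: (radD_eq (radDM (radDB dk dv) (radDV h0 dh))).
  by move=> y /h0 hy /=; field.
(* The derivative of [ga] enters the Ricci tensor twice with opposite signs, so its existence is
   enough and no formula is recorded. *)
have dga : exists ga1, radD U ga ga1.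
  have -> : ga = fun x => (k1 x * h x + k x * k x - be x * (k x * (1 + h x))) * (h x * h x)^-1.
    by apply/funext => y; rewrite /ga expr2.
  have hh0 y : U y -> h y * h y != 0 by move=> /h0 ?; rewrite mulf_neq0.
  eexists; apply: (radDM _ (radDV hh0 (radDM dh dh))).
  apply: (radDB (radDD (radDM dk1 dh) (radDM dk dk))).
  exact: (radDM dbe (radDM dk (radDD (radD_cst _) dh))).
have {dga}[ga1 dga] := dga.
have C' y : U y -> forall k i j, christoffel G k i j y =
  al y * y 0 k * kr i j + be y * (y 0 i * kr j k + y 0 j * kr i k) + ga y * y 0 i * y 0 j * y 0 k.
  move=> Uy p i j; rewrite C// -/be.
  have -> : chr_al q be y = al y.
    by rewrite /chr_al Hh /al /be /q /h; have := h0 Uy; rewrite /h => h'; field.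
  have -> // : chr_ga q be q1 y = ga y.
  by rewrite /chr_ga Hh /ga /q1 /q /h; have := h0 Uy; rewrite /h => h'; field.
have hx := h0 Ux; do 2 eexists; split.
- by move=> i j; rewrite (Ric_christoffel_radial oU C' dal dbe dga i j Ux) /=; reflexivity.
- rewrite /al /ga /be; move: hx; rewrite /h; set s := sqnorm x => hx.
  by field.
rewrite /al /ga /be; move: hx; rewrite /h; set s := sqnorm x => hx.
by field.
Qed.

End RicciRadialMetric.

End RicciRadial.

(** * Polar coordinates *)

Section Enorm.
Context {R : realType} {n : nat}.
Implicit Types (x y : 'rV[R]_n) (i j k : 'I_n) (e t : R).

Lemma sqnorm_ge0 x : 0 <= sqnorm x.
Proof. by apply: sumr_ge0 => i _; exact: sqr_ge0. Qed.

Lemma enorm_ge0 x : 0 <= enorm x. Proof. exact: sqrtr_ge0. Qed.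

Lemma enorm_sqr x : enorm x ^+ 2 = sqnorm x.
Proof. by rewrite sqr_sqrtr// sqnorm_ge0. Qed.

Lemma enorm_eq0 x : (enorm x == 0) = (x == 0).
Proof.
rewrite -sqrf_eq0 enorm_sqr; apply/eqP/eqP => [h|->]; last first.
  by apply: big1 => i _; rewrite mxE expr0n.
apply/rowP => i; rewrite mxE; apply/eqP; rewrite -sqrf_eq0; apply/eqP.
exact: (psumr_eq0P (fun i _ => sqr_ge0 (x 0 i)) h).
Qed.

Lemma enorm_gt0 x : (0 < enorm x) = (x != 0).
Proof. by rewrite lt_neqAle enorm_ge0 andbT eq_sym enorm_eq0. Qed.

Lemma enorm0 : enorm (0 : 'rV[R]_n) = 0.
Proof. by apply/eqP; rewrite enorm_eq0. Qed.

Lemma sqnorm_mul x : (x *m x^T) 0 0 = sqnorm x.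
Proof. by rewrite mxE; apply: eq_bigr => i _; rewrite mxE expr2. Qed.

Lemma enorm_orthogonal x (B : 'M[R]_n) : B *m B^T = 1%:M -> enorm (x *m B) = enorm x.
Proof.
move=> BB; rewrite /enorm; congr Num.sqrt; rewrite -/(sqnorm _) -/(sqnorm x) -!sqnorm_mul.
by rewrite trmx_mul mulmxA -(mulmxA x) BB mulmx1.
Qed.

Lemma coord_continuous j : continuous (fun x : 'rV[R]_n => x 0 j).
Proof. by move=> x; apply: differentiable_continuous; exact: differentiable_coord. Qed.

Lemma enorm_continuous : continuous (@enorm R n).
Proof.
move=> x; rewrite /enorm; apply: (@continuous_comp _ _ _ (@sqnorm R n) Num.sqrt).
  have -> : sqnorm = \sum_(j < n) (fun y : 'rV[R]_n => y 0 j ^+ 2).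
    by apply/funext => y; rewrite fct_sumE.
  apply: (big_ind (fun f : 'rV[R]_n -> R => {for x, continuous f})).
  - exact: (@cst_continuous _ _ (0 : R)).
  - by move=> f g cf cg; exact: (continuousD cf cg).
  - move=> j _; exact: (continuousM (@coord_continuous j x) (@coord_continuous j x)).
exact: sqrt_continuous.
Qed.

Lemma open_eball e : open (@eball R n e).
Proof. exact: (open_comp (fun x _ => @enorm_continuous x) (@open_lt R e)). Qed.

Lemma enorm_scale_delta t i : enorm (t *: delta_mx 0 i : 'rV[R]_n) = `|t|.
Proof.
rewrite /enorm (bigD1 i)//= big1 ?addr0; first by rewrite !mxE !eqxx mulr1 sqrtr_sqr.
by move=> j /negbTE ji; rewrite !mxE ji andbF mulr0 expr0n.
Qed.

(** On the punctured ball [enorm] is differentiable, so functions of [t] can be composed with it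
    whatever their parity. *)
Definition pball e : set 'rV[R]_n := [set x | 0 < enorm x < e].

Lemma open_pball e : open (pball e).
Proof.
have -> : pball e = [set x | 0 < enorm x] `&` @eball R n e.
  by apply/seteqP; split => x /=; [move/andP|move=> [x0 xe]; apply/andP].
apply: openI; last exact: open_eball.
exact: (open_comp (fun x _ => @enorm_continuous x) (@open_gt R 0)).
Qed.

Lemma hasD_enorm_comp (f : R -> R) (a : R) x i : x != 0 ->
  hasD (enorm x) (1 : R) f a ->
  hasD x (delta_mx 0 i) (fun y => f (enorm y)) (x 0 i * (a / enorm x)).
Proof.
move=> x0 df; have e0 : 0 < enorm x by rewrite enorm_gt0.
have ds : hasD x (delta_mx 0 i) (@enorm R n) (x 0 i / enorm x).
  apply: der_eq.
    apply: (@der_comp R _ Num.sqrt (@sqnorm R n)).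
      by apply: is_derive1_sqrt; rewrite -enorm_sqr exprn_gt0.
    exact: (@radD_sqnorm R n [set: 'rV[R]_n] x I i).
  rewrite -/(enorm x); have E : enorm x != 0 by rewrite gt_eqF.
  by field.
apply: der_eq; first by apply: der_comp; [exact: df|exact: ds].
by rewrite mulrCA.
Qed.

Lemma radD_enorm e (f f1 : R -> R) : (forall t, 0 < t < e -> hasD t (1 : R) f (f1 t)) ->
  radD (pball e) (fun y => f (enorm y)) (fun y => f1 (enorm y) / enorm y).
Proof.
move=> df x xe i; apply: hasD_enorm_comp; last exact: df.
by move: xe => /= /andP[]; rewrite enorm_gt0.
Qed.

(** At the origin, restriction to a coordinate axis is [f |s|], which evenness turns into the
    differentiable [f s]. *)
Lemma radD_enorm_even e (f f1 : R -> R) : evenOn e f ->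
  (forall t, `|t| < e -> hasD t (1 : R) f (t * f1 t)) ->
  radD (@eball R n e) (fun y => f (enorm y)) (fun y => f1 (enorm y)).
Proof.
move=> ev df x xe i; have [x0|x0] := eqVneq x 0; last first.
  have e0 : enorm x != 0 by rewrite enorm_eq0.
  have := @hasD_enorm_comp f _ x i x0 (df (enorm x) _).
  rewrite ger0_norm ?enorm_ge0// => /(_ xe) D; apply: der_eq D _.
  by congr (_ * _); field.
rewrite {}x0 in xe *; rewrite mxE mul0r; apply/der_line.
have e0 : 0 < e by move: xe; rewrite /eball/= enorm0.
apply: (@der_near _ _ f); last by rewrite -[X in hasD _ _ _ X](mul0r (f1 0)); apply: df; rewrite normr0.
near=> s; rewrite addr0 enorm_scale_delta.
have se : `|s| < e by near: s; apply: near_ball0; rewrite normr0.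
by have [s0|s0] := leP 0 s; [rewrite ger0_norm|rewrite ltr0_norm// ev].
Unshelve. all: by end_near. Qed.

Lemma partial_enorm x i : x != 0 -> partial i (@enorm R n) x = x 0 i / enorm x.
Proof.
move=> x0; apply: der_val; apply: der_eq.
  by apply: (@hasD_enorm_comp (fun t => t) 1) => //; exact: der_id.
by rewrite mul1r.
Qed.

Lemma partial_Theta x i k : x != 0 -> partial i (fun y => Theta y 0 k) x =
  ((i == k)%:R - x 0 i * x 0 k / sqnorm x) / enorm x.
Proof.
move=> x0; have e0 : enorm x != 0 by rewrite enorm_eq0.
have -> : (fun y : 'rV[R]_n => Theta y 0 k) = fun y => (enorm y)^-1 * y 0 k.
  by apply/funext => y; rewrite /Theta mxE.
apply: der_val; apply: der_eq.
  apply: derM; last exact: der_coord.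
  apply: (@hasD_enorm_comp (fun t => t^-1)) => //.
  by apply: derV; [exact: e0|exact: der_id].
by rewrite -enorm_sqr; field.
Qed.

Lemma dt2E x i j : x != 0 -> dt2 x i j = x 0 i * x 0 j / sqnorm x.
Proof. by move=> x0; rewrite mxE !partial_enorm// -enorm_sqr; field; rewrite enorm_eq0. Qed.

Lemma dTheta2E x i j : x != 0 ->
  dTheta2 x i j = ((i == j)%:R - x 0 i * x 0 j / sqnorm x) / sqnorm x.
Proof.
move=> x0; rewrite mxE; have e0 : enorm x != 0 by rewrite enorm_eq0.
have s0 : sqnorm x != 0 by rewrite -enorm_sqr expf_neq0.
transitivity (\sum_k ((enorm x)^-1 * (i == k)%:R + 0 * (i == k)%:R + (- (x 0 i / sqnorm x / enorm x)) * x 0 k) *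
  ((enorm x)^-1 * (j == k)%:R + 0 * (j == k)%:R + (- (x 0 j / sqnorm x / enorm x)) * x 0 k)).
  by apply: eq_bigr => k _; rewrite !partial_Theta//; field; rewrite e0 s0.
by rewrite sum_contract -!enorm_sqr; field.
Qed.

Lemma polarE U (T : 'rV[R]_n -> 'M[R]_n) (a b : R -> R) x i j : polar_on U T a b -> U x -> x != 0 ->
  T x i j = b (enorm x) / sqnorm x * (i == j)%:R +
    (a (enorm x) - b (enorm x) / sqnorm x) / sqnorm x * x 0 i * x 0 j.
Proof.
move=> TP Ux x0; have s0 : sqnorm x != 0 by rewrite -enorm_sqr expf_neq0// enorm_eq0.
have E (M N : 'M[R]_n) (c d : R) : (c *: M + d *: N) i j = c * M i j + d * N i j.
  by rewrite !mxE.
by rewrite (TP x Ux x0) E dt2E// dTheta2E//; field.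
Qed.

End Enorm.

(** * Even functions and smooth radial tensors *)

Section EvenSmooth.
Context {R : realType}.
Implicit Types (e d s t : R) (f g h : R -> R).

Lemma smoothOn_hasD e h : smoothOn e h ->
  forall t, `|t| < e -> hasD t (1 : R) h (derive1 h t).
Proof.
move=> sh t te; have [h1 [dh _]] := sh 1%N.
by have := dh t te => dht; apply: der_eq (dht) _; rewrite derive1E (der_val dht).
Qed.

Lemma smoothOn_derive1 e h : smoothOn e h -> smoothOn e (derive1 h).
Proof.
move=> sh k; have [h1 [dh ch]] := sh k.+1.
by apply: CkOn_ext ch => t te; rewrite derive1E (der_val (dh t te)).
Qed.

Lemma smoothOn_sub e d h : d <= e -> smoothOn e h -> smoothOn d h.
Proof. by move=> de sh k; exact: CkOn_sub de (sh k). Qed.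

Lemma smoothOn_CtOn e h : smoothOn e h -> CtOn e h.
Proof. by move=> sh; exact: (sh 0%N). Qed.

Lemma itv_ball e t : (`]- e, e[%classic t) = (`|t| < e) :> Prop.
Proof. by rewrite /= in_itv/= ltr_norml. Qed.

Lemma smooth1_onP e h : smooth1_on `]- e, e[ h <-> smoothOn e h.
Proof.
split=> [sh k|sh k t].
  elim: k h sh => [|k IH] h sh.
    by move=> t te; apply: (@der_cont _ _ _ ('D_1 h t)); apply/derP; split=> //; apply: (sh 0%N); rewrite itv_ball.
  exists (derive1 h); split; last first.
    by apply: IH => j t te; rewrite -derive1Sn; exact: sh.
  by move=> t te; rewrite derive1E; apply/derP; split=> //; apply: (sh 0%N); rewrite itv_ball.
rewrite itv_ball; elim: k h sh => [|k IH] h sh te.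
  by have /derP[] := smoothOn_hasD sh te.
by rewrite derive1Sn; apply: IH => //; exact: smoothOn_derive1.
Qed.

Lemma derive1_even_odd e h : smoothOn e h -> evenOn e h ->
  forall t, `|t| < e -> derive1 h (- t) = - derive1 h t.
Proof.
move=> sh ev t te; have dh := smoothOn_hasD sh.
have D : hasD t (1 : R) (fun t => h (- t)) (derive1 h (- t) * - 1).
  apply: (@der_comp R R h (fun t => - t)); last by apply: derN; exact: der_id.
  by apply: dh; rewrite normrN.
have D' : hasD t (1 : R) h (derive1 h (- t) * - 1) by exact: (hasD_ext ev te D).
by have := der_unique D' (dh t te); lra.
Qed.

Lemma derive1_odd_even e h : smoothOn e h -> (forall t, `|t| < e -> h (- t) = - h t) ->
  evenOn e (derive1 h).
Proof.
move=> sh od t te; have dh := smoothOn_hasD sh.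
have D : hasD t (1 : R) (fun t => - h (- t)) (- (derive1 h (- t) * - 1)).
  apply: derN; apply: (@der_comp R R h (fun t => - t)); last by apply: derN; exact: der_id.
  by apply: dh; rewrite normrN.
have D' : hasD t (1 : R) h (- (derive1 h (- t) * - 1)).
  by apply: hasD_ext te D => s se; rewrite od// opprK.
by have := der_unique D' (dh t te); lra.
Qed.

(** Since [h'] is odd it vanishes at 0, and [h' / t] is the plain mean of the even function
    [h'']. *)
Lemma even_smooth_D e h : 0 < e -> smoothOn e h -> evenOn e h ->
  exists h1, [/\ smoothOn e h1, evenOn e h1 & forall t, `|t| < e -> hasD t (1 : R) h (t * h1 t)].
Proof.
move=> e0 sh ev; have sh1 := smoothOn_derive1 sh; have sh2 := smoothOn_derive1 sh1.
have od := derive1_even_odd sh ev; have ev2 := derive1_odd_even sh1 od.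
have c2 := smoothOn_CtOn sh2.
exists (wmean e 1 (derive1 (derive1 h))); split.
- by move=> k; exact: CkOn_wmean.
- by move=> t te; exact: wmean_even.
move=> t te; apply: der_eq (smoothOn_hasD sh te) _.
pose q s := derive1 h s - s * wmean e 1 (derive1 (derive1 h)) s.
have q0 : q 0 = 0.
  have := od 0; rewrite oppr0 normr0 => /(_ e0) h0.
  by rewrite /q mul0r; lra.
suff : q t = q 0 by rewrite q0 /q => /eqP; rewrite subr_eq0 => /eqP.
apply: (@cst_off0 _ e) => //.
  apply: (@CkOnB R 0); first exact: (sh1 0%N).
  by apply: (@CkOnM R 0); [exact: (@CkOn_id R 0)|exact: wmean_CtOn].
move=> s se s0; apply: der_eq.
  apply: derB; first apply: (smoothOn_hasD sh1 se).
  by apply: derM; [exact: der_id|exact: wmean_der].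
by rewrite /=; field.
Qed.

(** With [h' = s h1], integrating from 0 gives [t^2] times the mean of [h1] with weight 2. *)
Lemma even_smooth_div e h : 0 < e -> smoothOn e h -> evenOn e h -> h 0 = 0 ->
  exists a, [/\ smoothOn e a, evenOn e a & forall t, `|t| < e -> h t = t ^+ 2 * a t].
Proof.
move=> e0 sh ev h0; have [h1 [s1 e1 d1]] := even_smooth_D e0 sh ev.
have c1 := smoothOn_CtOn s1.
exists (wmean e 2 h1); split.
- by move=> k; exact: CkOn_wmean.
- by move=> t te; exact: wmean_even.
move=> t te; pose q s := h s - s ^+ 2 * wmean e 2 h1 s.
suff : q t = q 0 by rewrite /q h0 expr0n mul0r subrr => /eqP; rewrite subr_eq0 => /eqP.
apply: (@cst_off0 _ e) => //.
  apply: (@CkOnB R 0); first exact: (sh 0%N).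
  by apply: (@CkOnM R 0); [apply: (@CkOnX R 0); exact: (@CkOn_id R 0)|exact: wmean_CtOn].
move=> s se s0; apply: der_eq.
  apply: derB; first exact: d1.
  by apply: derM; [apply: derX; exact: der_id|exact: wmean_der].
by rewrite /=; field.
Qed.

Lemma even_smooth_primitive e k : smoothOn e k -> evenOn e k ->
  exists K, [/\ smoothOn e K, evenOn e K, K 0 = 0 & forall t, `|t| < e -> hasD t (1 : R) K (t * k t)].
Proof.
move=> sk ev; have stk : smoothOn e (fun t => t * k t).
  by move=> j; apply: CkOnM; [exact: CkOn_id|exact: sk].
have [K0 dK] := primitiveP (smoothOn_CtOn stk); set K := primitive _ _ in K0 dK.
have sK : smoothOn e K.
  by case=> [|j]; [exact: der_CtOn dK|exists (fun t => t * k t); split].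
exists K; split=> // t te.
have dq s : `|s| < e -> hasD s (1 : R) (fun s => K (- s) - K s) 0.
  move=> se; apply: der_eq.
    apply: derB; last exact: dK.
    apply: (@der_comp R R K (fun t => - t)); last by apply: derN; exact: der_id.
    by apply: dK; rewrite normrN.
  by rewrite /= ev//; ring.
have := cst_off0 (der_CtOn dq) (fun s se _ => dq s se) te.
by rewrite oppr0 subrr => /eqP; rewrite subr_eq0 => /eqP.
Qed.

End EvenSmooth.

(** * Smoothness in Cartesian coordinates of functions of [|x|] *)

Section SmoothRadial.
Context {R : realType} {n : nat}.
Variable e : R.
Hypothesis e0 : 0 < e.
Implicit Types (x y : 'rV[R]_n) (F G : 'rV[R]_n -> R).

(** An algebra of functions stable under partial derivatives ([radpoly_hasD]), so that continuity
    and differentiability of its members propagate to all orders. It contains the entries of the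
    metric to be constructed. *)
Inductive radpoly : ('rV[R]_n -> R) -> Prop :=
| radpoly_cst c : radpoly (fun=> c)
| radpoly_coord j : radpoly (fun x => x 0 j)
| radpoly_even (h : R -> R) : smoothOn e h -> evenOn e h -> radpoly (fun x => h (enorm x))
| radpolyD F G : radpoly F -> radpoly G -> radpoly (fun x => F x + G x)
| radpolyM F G : radpoly F -> radpoly G -> radpoly (fun x => F x * G x).

Lemma radpoly_hasD F : radpoly F -> forall i, exists F1, radpoly F1 /\
  forall x, eball e x -> hasD x (delta_mx 0 i) F (F1 x).
Proof.
elim=> [c|j|h sh ev|{}F G rF IF rG IG|{}F G rF IF rG IG] i.
- by exists (fun=> 0); split; [exact: radpoly_cst|move=> x _; exact: der_cst].
- exists (fun=> (i == j)%:R); split; [exact: radpoly_cst|move=> x _; exact: der_coord].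
- have [h1 [s1 e1 d1]] := even_smooth_D e0 sh ev.
  exists (fun x => x 0 i * h1 (enorm x)); split.
    by apply: radpolyM; [exact: radpoly_coord|exact: radpoly_even].
  by move=> x xe; exact: radD_enorm_even ev d1 x xe i.
- have [F1 [r1 d1]] := IF i; have [G1 [r2 d2]] := IG i.
  exists (fun x => F1 x + G1 x); split; first exact: radpolyD.
  by move=> x xe; apply: derD; [exact: d1|exact: d2].
- have [F1 [r1 d1]] := IF i; have [G1 [r2 d2]] := IG i.
  exists (fun x => F1 x * G x + F x * G1 x); split.
    by apply: radpolyD; exact: radpolyM.
  by move=> x xe; apply: derM; [exact: d1|exact: d2].
Qed.

Lemma radpoly_continuous F x : radpoly F -> eball e x -> {for x, continuous F}.
Proof.
move=> rF xe; elim: rF => [c|j|h sh ev|{}F G _ cF _ cG|{}F G _ cF _ cG].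
- exact: cst_continuous.
- exact: coord_continuous.
- apply: (@continuous_comp _ _ _ (@enorm R n) h); first exact: enorm_continuous.
  by apply: smoothOn_CtOn sh _ _; rewrite ger0_norm ?enorm_ge0.
- exact: (continuousD cF cG).
- exact: (continuousM cF cG).
Qed.

Lemma near_eball x F G : (forall y, eball e y -> F y = G y) -> eball e x ->
  \forall y \near x, F y = G y.
Proof. by move=> E xe; apply: filterS (open_nbhs_nbhs (conj (@open_eball R n e) xe)) => y /E. Qed.

Lemma radpoly_smooth F G : radpoly F -> (forall x, eball e x -> G x = F x) ->
  smooth_on (@eball R n e) G.
Proof.
move=> rF GF s.
have [Fs [rs Es]] : exists Fs, radpoly Fs /\ forall x, eball e x -> partials s G x = Fs x.
  elim: s => [|i s [Fs [rs Es]]]; first by exists F.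
  have [F1 [r1 d1]] := radpoly_hasD rs i; exists F1; split=> // x xe.
  by apply: (partial_near (@open_eball R n e) xe Es); exact: d1.
move=> x xe; have NE : \forall y \near x, Fs y = partials s G y.
  by apply: near_eball xe => y /Es.
split.
  have := radpoly_continuous rs xe; rewrite /prop_for /continuous_at -(Es x xe).
  by apply: cvg_trans; exact: (@near_eq_cvg _ _ (nbhs x) (nbhs_filter x) _ _ NE).
move=> i; have [F1 [_ d1]] := radpoly_hasD rs i.
by have /derP[] := der_near NE (d1 x xe).
Qed.

End SmoothRadial.

(** * The differential equation satisfied by a solution *)

Section LineRestriction.
Context {R : realType} {n : nat}.
Implicit Types (x y : 'rV[R]_n) (F G : 'rV[R]_n -> R) (i j : 'I_n).

Lemma hasD_line F i (t a : R) : hasD (t *: delta_mx 0 i : 'rV[R]_n) (delta_mx 0 i) F a ->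
  hasD t (1 : R) (fun s => F (s *: delta_mx 0 i)) a.
Proof.
move=> /der_line D.
apply: (@der_near _ _ (fun s => F ((s - t) *: delta_mx 0 i + t *: delta_mx 0 i))).
  by near=> s; rewrite -scalerDl subrK.
apply: der_eq.
  apply: (@der_comp R R (fun h => F (h *: delta_mx 0 i + t *: delta_mx 0 i)) (fun s => s - t)).
    by rewrite subrr; exact: D.
  by apply: derB; [exact: der_id|exact: der_cst].
by rewrite subr0 mulr1.
Unshelve. all: by end_near. Qed.

Lemma smooth_on_line F i e : smooth_on [set: 'rV[R]_n] F ->
  smoothOn e (fun t => F (t *: delta_mx 0 i)).
Proof.
move=> sF k; rewrite -[F]/(partials [::] F).
have D s (t : R) : hasD t (1 : R) (fun t => partials s F (t *: delta_mx 0 i))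
    (partials (i :: s) F (t *: delta_mx 0 i)).
  by apply: hasD_line; apply/derP; split=> //; apply: (sF s _ I).2.
elim: k [::] => [|k IH] s; first by move=> t _; exact: der_cont (D s t).
by exists (fun t => partials (i :: s) F (t *: delta_mx 0 i)); split.
Qed.

(** The polar form says nothing at the origin; values there are recovered as limits along a
    half-axis. *)
Lemma eq_at0 F G i e : 0 < e -> {for 0, continuous F} -> {for 0, continuous G} ->
  (forall t, 0 < t < e -> F (t *: delta_mx 0 i) = G (t *: delta_mx 0 i)) -> F 0 = G 0.
Proof.
move=> e0 cF cG E; pose u t := F (t *: delta_mx 0 i) - G (t *: delta_mx 0 i).
have cu : {for (0 : R), continuous u}.
  have cl : {for (0 : R), continuous (fun t : R => t *: (delta_mx 0 i : 'rV[R]_n))}.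
    exact: scalel_continuous.
  by apply: continuousB; apply: continuous_comp; rewrite ?scale0r.
apply/eqP; rewrite -subr_eq0 -normr_eq0; apply/eqP/le_anti; rewrite normr_ge0 andbT.
apply/ler_addgt0Pl => eps eps0; rewrite addr0.
have /cvgrPdist_lt/(_ eps eps0)/nbhs_ballP[d /= d0 D] := cu.
pose s := Num.min d e / 2.
have m0 : 0 < Num.min d e by rewrite lt_min d0 e0.
have s0 : 0 < s by rewrite /s; lra.
have [sd se] : s < d /\ s < e.
  have : s < Num.min d e by rewrite /s; lra.
  by rewrite lt_min => /andP.
have := D s; rewrite /ball/= sub0r normrN gtr0_norm// => /(_ sd).
by rewrite /u (E s) ?s0// subrr subr0 scale0r => /ltW.
Qed.

Lemma smooth_on_continuous U F x : smooth_on U F -> U x -> {for x, continuous F}.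
Proof. by move=> sF Ux; exact: (sF [::] x Ux).1. Qed.

End LineRestriction.

(** * The tensor on the axes and at the origin *)

Section PolarTensor.
Context {R : realType} {n : nat}.
Variables (T : 'rV[R]_n -> 'M[R]_n) (phi psi : R -> R) (i0 i1 : 'I_n).
Hypotheses (i01 : i0 != i1).
Hypothesis Tsmooth : smooth_tensor_on [set: 'rV[R]_n] T.
Hypothesis Tpolar : polar_on [set: 'rV[R]_n] T phi (fun t => t ^+ 2 * psi t).

(** The given [phi] and [psi] are unconstrained at 0 and at negative arguments. Entries of [T] along
    an axis agree with them for [t > 0] and are smooth and even on the whole line. *)
Definition phiT t := T (t *: delta_mx 0 i0) i0 i0.
Definition psiT t := T (t *: delta_mx 0 i0) i1 i1.

Lemma polar_entries x i j : x != 0 ->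
  T x i j = psi (enorm x) * (i == j)%:R +
    (phi (enorm x) - psi (enorm x)) / sqnorm x * x 0 i * x 0 j.
Proof.
move=> x0; rewrite (polarE i j Tpolar I x0) -enorm_sqr; field.
by rewrite enorm_eq0.
Qed.

Lemma polar_entries_axis t l i j : t != 0 ->
  T (t *: delta_mx 0 l) i j = if i == j then if i == l then phi `|t| else psi `|t| else 0.
Proof.
move=> t0; have x0 : t *: delta_mx 0 l != 0 :> 'rV[R]_n.
  by rewrite -enorm_eq0 enorm_scale_delta normr_eq0.
rewrite polar_entries// -enorm_sqr enorm_scale_delta real_normK ?num_real// !mxE eqxx/=.
have [<-|ij] := eqVneq i j; first by have [_|_] := eqVneq i l; rewrite /=; field.
have [il|_] := eqVneq i l; have [jl|_] := eqVneq j l; rewrite /= ?mulr0 ?mul0r ?addr0//.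
by rewrite il jl eqxx in ij.
Qed.

Lemma phiTE t : t != 0 -> phiT t = phi `|t|.
Proof. by move=> t0; rewrite /phiT polar_entries_axis// !eqxx. Qed.

Lemma psiTE t : t != 0 -> psiT t = psi `|t|.
Proof. by move=> t0; rewrite /psiT polar_entries_axis// eqxx eq_sym (negbTE i01). Qed.

Lemma phiT_smooth e : smoothOn e phiT.
Proof. exact: (@smooth_on_line _ _ (fun x => T x i0 i0)). Qed.

Lemma psiT_smooth e : smoothOn e psiT.
Proof. exact: (@smooth_on_line _ _ (fun x => T x i1 i1)). Qed.

Lemma phiT_even e : evenOn e phiT.
Proof.
move=> t _; have [->|t0] := eqVneq t 0; first by rewrite oppr0.
by rewrite !phiTE ?normrN ?oppr_eq0.
Qed.

Lemma psiT_even e : evenOn e psiT.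
Proof.
move=> t _; have [->|t0] := eqVneq t 0; first by rewrite oppr0.
by rewrite !psiTE ?normrN ?oppr_eq0.
Qed.

(** Along axis [l], the diagonal entry of index [i != l] equals [psi], so its limit at 0 does not
    depend on [i] or [l]; varying the axis compares all diagonal entries. *)
Lemma polar_at0 i j : T 0 i j = psiT 0 * (i == j)%:R.
Proof.
have cT k l : {for (0 : 'rV[R]_n), continuous (fun x => T x k l)}.
  exact: (smooth_on_continuous (Tsmooth k l)).
have [<-|ij] := eqVneq i j; last first.
  rewrite mulr0; apply: (@eq_at0 _ _ (fun x => T x i j) (fun=> 0) i0 1) => //.
    exact: cst_continuous.
  by move=> t /andP[t0 _]; rewrite polar_entries_axis ?(lt0r_neq0 t0)// (negbTE ij).
rewrite mulr1.
have key l k : i != l -> k != i0 -> T 0 i i = T 0 k k.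
  move=> il ki.
  have H1 : T 0 i i = (fun t => T (t *: delta_mx 0 l) i i) 0 by rewrite /= scale0r.
  have H2 : T 0 k k = (fun t => T (t *: delta_mx 0 i0) k k) 0 by rewrite /= scale0r.
  have s1 := smoothOn_CtOn (smooth_on_line l 1 (Tsmooth i i)).
  have s2 := smoothOn_CtOn (smooth_on_line i0 1 (Tsmooth k k)).
  pose u t := T (t *: delta_mx 0 l) i i - T (t *: delta_mx 0 i0) k k.
  rewrite H1 H2; apply/eqP; rewrite -subr_eq0; apply/eqP; rewrite -/(u 0).
  (* The two entries live on different axes; as a function of one coordinate their difference fits
     [eq_at0]. *)
  pose U (x : 'rV[R]_n) := u (x 0 i0).
  have -> : u 0 = U 0 by rewrite /U mxE.
  apply: (@eq_at0 _ _ U (fun=> 0) i0 1) => //; last 1 first.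
  - move=> t /andP[t0 _]; rewrite /U /u !mxE !eqxx mulr1.
    by rewrite !polar_entries_axis ?(lt0r_neq0 t0)// !eqxx (negbTE il) (negbTE ki) subrr.
  - apply: (@continuous_comp _ _ _ (fun x : 'rV[R]_n => x 0 i0) u); first exact: coord_continuous.
    rewrite mxE; have lt01' : `|0 : R| < 1 by rewrite normr0.
    exact: continuousB (s1 0 lt01') (s2 0 lt01').
  exact: cst_continuous.
rewrite /psiT scale0r; have i10 : i1 != i0 by rewrite eq_sym.
have [ii0|ii0] := eqVneq i i0; first by apply: (key i1) => //; rewrite ii0.
exact: (key i0).
Qed.

Lemma phiT_psiT0 : phiT 0 = psiT 0.
Proof. by rewrite {1}/phiT scale0r polar_at0 eqxx mulr1. Qed.

Lemma nonsingular_at0 : nonsingular_on [set: 'rV[R]_n] T -> psiT 0 != 0.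
Proof.
move=> /(_ 0 I); apply: contraTneq => c0.
have -> : T 0 = 0 by apply/matrixP => i j; rewrite polar_at0 c0 mul0r mxE.
rewrite unitmxE unitfE negbK; case: n i0 => [[]//|m _]; exact/eqP/det0.
Qed.

End PolarTensor.

(** * The Ricci tensor away from the origin *)

Section RicciOfRadialMetric.
Context {R : realType} {n : nat}.
Variables (e : R) (f f1 f2 r r1 r2 r3 : R -> R) (g : 'rV[R]_n -> 'M[R]_n).
Hypothesis df : forall t : R, 0 < t < e -> hasD t (1 : R) f (f1 t).
Hypothesis df1 : forall t : R, 0 < t < e -> hasD t (1 : R) f1 (f2 t).
Hypothesis dr : forall t : R, 0 < t < e -> hasD t (1 : R) r (r1 t).
Hypothesis dr1 : forall t : R, 0 < t < e -> hasD t (1 : R) r1 (r2 t).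
Hypothesis dr2 : forall t : R, 0 < t < e -> hasD t (1 : R) r2 (r3 t).
Hypothesis pos : forall t : R, 0 < t < e -> 0 < r t /\ 0 < r1 t.
Hypothesis gp : polar_on (@eball R n e) g (fun t => expR (2 * f t) * r1 t ^+ 2)
                           (fun t => expR (2 * f t) * r t ^+ 2).

Let nz (t : R) : 0 < t < e -> [/\ t != 0, r t != 0 & r1 t != 0].
Proof. by move=> te; have [a b] := pos te; split; rewrite gt_eqF//; case/andP: te. Qed.

Let p s := f1 s * r s / r1 s.
Let p' s := (f2 s * r s + f1 s * r1 s) / r1 s - f1 s * r s * r2 s / r1 s ^+ 2.
Let A s := expR (2 * f s) * r s ^+ 2 / s ^+ 2.
Let k s := (s * r1 s / r s - 1) / s ^+ 2.
Let v s := p s / s ^+ 2.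
Let k' s := (r1 s + s * r2 s) / r s / s ^+ 2 - s * r1 s ^+ 2 / r s ^+ 2 / s ^+ 2
  - 2 * (s * r1 s / r s - 1) / s ^+ 3.

Let dp (s : R) : 0 < s < e -> hasD s (1 : R) p (p' s).
Proof.
move=> se; have [s0 rs0 rs1] := nz se; apply: der_eq.
  apply: derM; first by apply: derM; [exact: df1|exact: dr].
  by apply: derV; [exact: rs1|exact: dr1].
by rewrite /p' /=; field.
Qed.

Let dk (s : R) : 0 < s < e -> hasD s (1 : R) k (k' s).
Proof.
move=> se; have [s0 rs0 rs1] := nz se; apply: der_eq.
  apply: derM; last by apply: derV; [rewrite expf_neq0|apply: derX; exact: der_id].
  apply: derB; last exact: der_cst.
  apply: derM; first by apply: derM; [exact: der_id|exact: dr1].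
  by apply: derV; [exact: rs0|exact: dr].
by rewrite /k' /=; field; rewrite s0 rs0.
Qed.

Let dk1 (s : R) : 0 < s < e ->
  hasD s (1 : R) (fun s => k' s / s) (derive1 (fun s => k' s / s) s).
Proof.
move=> se; suff [a da] : exists a, hasD s (1 : R) (fun s => k' s / s) a.
  by apply: der_eq (da) _; rewrite derive1E (der_val da).
have [s0 rs0 rs1] := nz se.
have sX m : s ^+ m != 0 by rewrite expf_neq0.
have dVX m : hasD s (1 : R) (fun s => (s ^+ m)^-1) (- (m%:R * s ^+ m.-1 * 1) / (s ^+ m) ^+ 2).
  by apply: derV; [exact: sX|apply: derX; exact: der_id].
have dVr : hasD s (1 : R) (fun s => (r s)^-1) (- r1 s / r s ^+ 2).
  by apply: derV; [exact: rs0|exact: dr].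
eexists; apply: derM; last by apply: derV; [exact: s0|exact: der_id].
apply: derB; last first.
  apply: derM; last exact: dVX.
  apply: derM; first exact: der_cst.
  apply: derB; last exact: der_cst.
  by apply: derM; [apply: derM; [exact: der_id|exact: dr1]|exact: dVr].
apply: derB.
  apply: derM; last exact: dVX.
  apply: derM; last exact: dVr.
  by apply: derD; [exact: dr1|apply: derM; [exact: der_id|exact: dr2]].
apply: derM; last exact: dVX.
apply: derM; last by apply: derV; [rewrite expf_neq0|apply: derX; exact: dr].
by apply: derM; [exact: der_id|apply: derX; exact: dr1].
Qed.

Let dv (s : R) : 0 < s < e -> hasD s (1 : R) v (p' s / s ^+ 2 - 2 * p s / s ^+ 3).
Proof.
move=> se; have [s0 rs0 rs1] := nz se; apply: der_eq.
  by apply: derM; [exact: dp|apply: derV; [rewrite expf_neq0|apply: derX; exact: der_id]].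
by rewrite /=; field.
Qed.

Let dA (s : R) : 0 < s < e ->
  hasD s (1 : R) A (2 * A s * (v s * (1 + s ^+ 2 * k s) + k s) * s).
Proof.
move=> se; have [s0 rs0 rs1] := nz se; apply: der_eq.
  apply: derM; last by apply: derV; [rewrite expf_neq0|apply: derX; exact: der_id].
  apply: derM; last by apply: derX; exact: dr.
  apply: (@der_comp R R expR (fun s => 2 * f s)); first exact: is_derive_expR.
  by apply: derM; [exact: der_cst|exact: df].
by rewrite /v /k /A /p /=; field; rewrite s0 rs0 rs1.
Qed.

(** For a given metric nothing is known about the parity of [f] and [r], so the Cartesian formula is
    applied on the punctured ball, to the coefficients [A], [k], [v] above; there [h = 1 + t^2 k]
    and [y = p' / t]. *)
Lemma Ric_polar_metric x : pball e x ->
  let t := enorm x in let h := t * r1 t / r t in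
  exists y P Q : R, [/\ hasD t (1 : R) (fun s => f1 s * r s / r1 s) (t * y),
    forall i j, Ric g x i j = P * (i == j)%:R + Q * x 0 i * x 0 j,
    P = - (y / h + (n%:R - 2) * (2 * p t + p t ^+ 2) / t ^+ 2) &
    P + t ^+ 2 * Q = - (n%:R - 1) * y * h].
Proof.
move=> px t h.
have GE y : pball e y -> forall i j, g y i j = A (enorm y) *
    ((i == j)%:R + (2 * k (enorm y) + sqnorm y * k (enorm y) ^+ 2) * y 0 i * y 0 j).
  move=> py i j; have [y0 rs0 rs1] := nz py; have [_ ylt] := andP py.
  rewrite (polarE i j gp ylt) -?enorm_eq0// -enorm_sqr /A /k; field.
  by rewrite y0 rs0.
have hE (y : 'rV[R]_n) : pball e y -> 1 + sqnorm y * k (enorm y) = enorm y * r1 (enorm y) / r (enorm y).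
  by move=> py; have [y0 rs0 rs1] := nz py; rewrite -enorm_sqr /k; field; rewrite y0 rs0.
have A0 (y : 'rV[R]_n) : pball e y -> A (enorm y) != 0.
  move=> py; have [y0 rs0 rs1] := nz py.
  by rewrite !mulf_neq0 ?invr_eq0 ?expf_neq0// gt_eqF// expR_gt0.
have h0 (y : 'rV[R]_n) : pball e y -> 1 + sqnorm y * k (enorm y) != 0.
  by move=> py; have [y0 rs0 rs1] := nz py; rewrite hE// !mulf_neq0// invr_eq0.
have rA : radD (@pball R n e) (fun y => A (enorm y))
    (fun y => 2 * A (enorm y) * (v (enorm y) * (1 + sqnorm y * k (enorm y)) + k (enorm y))).
  apply: (radD_eq (radD_enorm dA)) => y py; have [y0 _ _] := nz py.
  by rewrite -enorm_sqr; field.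
have [P [Q [RE PE QE]]] := Ric_radial_metric (@open_pball R n e) GE rA (radD_enorm dk)
  (radD_enorm dv) (radD_enorm dk1) A0 h0 px.
have [t0 rt0 rt1] := nz px; rewrite -/t in t0 rt0 rt1.
rewrite hE// -enorm_sqr -/t -/h in PE QE.
have yE : 2 * v t + t ^+ 2 * ((p' t / t ^+ 2 - 2 * p t / t ^+ 3) / t) = p' t / t.
  by rewrite /v; field.
rewrite yE in PE QE.
exists (p' t / t), P, Q; split=> //.
- by apply: der_eq (dp px) _; rewrite -/t; field.
- by rewrite PE /v; congr (- (_ + _)); field.
Qed.

End RicciOfRadialMetric.

Section SolutionOde.
Context {R : realType} {n : nat}.
Variables (T : 'rV[R]_n -> 'M[R]_n) (i0 i1 : 'I_n) (e : R) (f r : R -> R) (g : 'rV[R]_n -> 'M[R]_n).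
Hypotheses (i01 : i0 != i1) (rm : radial_metric e f r g).
Hypothesis gT : forall x, eball e x -> Ric g x = T x.

Lemma radial_metric_smooth : smoothOn e f /\ smoothOn e r.
Proof. by have [_ _ [/smooth1_onP ? /smooth1_onP ?] _ _] := rm. Qed.

Lemma radial_metric_pos (t : R) : 0 < t < e -> 0 < r t /\ 0 < derive1 r t.
Proof.
move=> /andP[t0 te]; have [_ _ _ [r0 _ rp] _] := rm; have [_ sr] := radial_metric_smooth.
split; last by apply: rp; rewrite ltW.
have [||s] := @MVT _ r (derive1 r) 0 t t0.
- move=> s; rewrite in_itv/= => /andP[s0 st]; apply: (smoothOn_hasD sr).
  by rewrite gtr0_norm//; exact: lt_trans te.
- by apply: within_CtOn (smoothOn_CtOn sr) _ _ => //; lra.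
rewrite in_itv/= r0 !subr0 => /andP[s0 st] ->; rewrite mulr_gt0//.
by apply: rp; rewrite ltW//=; exact: lt_trans te.
Qed.

(** This is the derivative of [f] with respect to [log r], hence unchanged when [r] is rescaled or a
    constant is added to [f]. *)
Definition profile t := derive1 f t * r t / derive1 r t.

(** The radial entry and one tangential entry of [Ric g = T], read at a point of the axis [i0]. *)
Lemma solution_ode (t : R) : 0 < t < e -> let h := t * derive1 r t / r t in
  exists y, [/\ hasD t (1 : R) profile (t * y),
    phiT T i0 t = - (n%:R - 1) * y * h &
    psiT T i0 i1 t = - (y / h + (n%:R - 2) * (2 * profile t + profile t ^+ 2) / t ^+ 2)].
Proof.
move=> te h.
have [sf sr] := radial_metric_smooth.
have sf1 := smoothOn_derive1 sf; have sr1 := smoothOn_derive1 sr; have sr2 := smoothOn_derive1 sr1.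
have abs (s : R) : 0 < s < e -> `|s| < e by move=> /andP[s0 se]; rewrite gtr0_norm.
have df s (se : 0 < s < e) := smoothOn_hasD sf (abs s se).
have df1 s (se : 0 < s < e) := smoothOn_hasD sf1 (abs s se).
have dr s (se : 0 < s < e) := smoothOn_hasD sr (abs s se).
have dr1 s (se : 0 < s < e) := smoothOn_hasD sr1 (abs s se).
have dr2 s (se : 0 < s < e) := smoothOn_hasD sr2 (abs s se).
have tE : enorm (t *: delta_mx 0 i0 : 'rV[R]_n) = t.
  by rewrite enorm_scale_delta; case/andP: te => t0 ?; rewrite gtr0_norm.
have tp : pball e (t *: delta_mx 0 i0 : 'rV[R]_n) by rewrite /pball/= tE.
have te' : eball e (t *: delta_mx 0 i0 : 'rV[R]_n) by rewrite /eball/= tE; case/andP: te.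
have [_ _ _ _ gp] := rm.
have [y [P [Q []]]] := Ric_polar_metric df df1 dr dr1 dr2 radial_metric_pos gp tp.
rewrite tE => dy RE PE QE; exists y; split=> //.
- rewrite /phiT -gT// RE !mxE !eqxx/= !mulr1 -QE; ring.
- by rewrite /psiT -gT// RE !mxE !eqxx/= (eq_sym i1) (negbTE i01) !mulr0 addr0 mulr1.
Qed.

End SolutionOde.

(** * Uniqueness *)

Lemma cst_on_interval {R : realType} (u : R -> R) (d s t : R) :
  (forall x : R, 0 < x < d -> hasD x (1 : R) u 0) -> 0 < s < d -> 0 < t < d -> u s = u t.
Proof.
move=> du; wlog st : s t / s < t.
  by move=> W sd td; have [st|st|->//] := ltgtP s t; [|symmetry]; exact: W.
move=> /andP[s0 sd] /andP[t0 td].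
have [||x _ /eqP] := @MVT _ u (fun=> 0) s t st.
- move=> x; rewrite in_itv/= => /andP[sx xt]; apply: du.
  by rewrite (lt_trans s0 sx) (lt_trans xt td).
- apply: derivable_within_continuous => x; rewrite in_itv/= => /andP[sx xt].
  have xd : 0 < x < d by rewrite (lt_le_trans s0 sx) (le_lt_trans xt td).
  by have /derP[] := du x xd.
by rewrite mul0r subr_eq0 => /eqP.
Qed.

Section Uniqueness.
Context {R : realType} {n : nat}.
Variables (T : 'rV[R]_n -> 'M[R]_n) (phi psi : R -> R) (i0 i1 : 'I_n).
Hypotheses (n2 : (2 <= n)%N) (i01 : i0 != i1).
Hypothesis Tsmooth : smooth_tensor_on [set: 'rV[R]_n] T.
Hypothesis Tnonsing : nonsingular_on [set: 'rV[R]_n] T.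
Hypothesis Tpolar : polar_on [set: 'rV[R]_n] T phi (fun t => t ^+ 2 * psi t).

(** Near 0 the denominator is positive because [r'(0) = 1]; the value 0 is the initial condition
    shared by all solutions. *)
Lemma profile_CtOn e f r g : 0 < e -> radial_metric (R := R) (n := n) e f r g ->
  exists d, [/\ 0 < d, d <= e, CtOn d (profile f r) & profile f r 0 = 0].
Proof.
move=> e0 rm; have [sf sr] := radial_metric_smooth rm.
have [_ _ _ [r0 r10 _] _] := rm.
have sf1 := smoothOn_derive1 sf; have sr1 := smoothOn_derive1 sr.
have [|d [d0 de pos]] := CtOn_pos e0 (smoothOn_CtOn sr1); first by rewrite r10.
exists d; split=> //; last by rewrite /profile r0 mulr0 mul0r.
apply: (@CkOnM R 0); first by apply: (@CkOnM R 0); apply: (@CkOn_sub R 0 _ _ _ de); [exact: (sf1 0%N)|exact: (sr 0%N)].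
apply: (@CkOnV R 0); first by move=> t /pos; exact: lt0r_neq0.
by apply: (@CkOn_sub R 0 _ _ _ de); exact: (sr1 0%N).
Qed.

Section TwoSolutions.
Variables (ea eb : R) (fa ra fb rb : R -> R) (ga gb : 'rV[R]_n -> 'M[R]_n).
Hypotheses (ea0 : 0 < ea) (eb0 : 0 < eb).
Hypotheses (rma : radial_metric ea fa ra ga) (rmb : radial_metric eb fb rb gb).
Hypothesis gTa : forall x, eball ea x -> Ric ga x = T x.
Hypothesis gTb : forall x, eball eb x -> Ric gb x = T x.

Local Notation pa := (profile fa ra).
Local Notation pb := (profile fb rb).

(* The squared difference of the two profiles vanishes at [0] and is nonincreasing. *)
Lemma profiles_agree : exists d : R, [/\ 0 < d, d <= ea, d <= eb &
  forall t : R, 0 < t < d -> pa t = pb t /\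
    exists y : R, [/\ y != 0, phiT T i0 t = - (n%:R - 1) * y * (t * derive1 ra t / ra t) &
      phiT T i0 t = - (n%:R - 1) * y * (t * derive1 rb t / rb t)]].
Proof.
have [da [da0 dae ca pa0]] := profile_CtOn ea0 rma.
have [db [db0 dbe cb pb0]] := profile_CtOn eb0 rmb.
pose c := phiT T i0 0.
have c0 : c != 0.
  by rewrite /c (phiT_psiT0 i01 Tsmooth Tpolar); exact: (nonsingular_at0 i01 Tsmooth Tpolar).
(* Near 0, [phi] keeps the sign of [c]; likewise [2 + pa + pb] stays positive, both profiles being
   small. *)
have [||dc [dc0 dce posc]] := @CtOn_pos R 1 (fun t => c * phiT T i0 t) ltr01.
- by apply: (@CkOnZ R 0); exact: (phiT_smooth i0 Tsmooth).
- by rewrite -/c -expr2 lt_neqAle sqr_ge0 eq_sym sqrf_eq0 c0.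
have dab0 : 0 < Num.min da db by rewrite lt_min da0.
have [||dw [dw0 dwe posw]] := @CtOn_pos R (Num.min da db) (fun t => 2 + pa t + pb t) dab0.
- apply: (@CkOnD R 0); first apply: (@CkOnD R 0); first exact: CkOn_cst.
    by apply: (@CkOn_sub R 0 _ _ _ _ ca); rewrite ge_min lexx.
  by apply: (@CkOn_sub R 0 _ _ _ _ cb); rewrite ge_min lexx orbT.
- by rewrite pa0 pb0 !addr0.
pose d := Num.min dc dw.
have d0 : 0 < d by rewrite lt_min dc0.
have [ddc ddw] : d <= dc /\ d <= dw by rewrite !ge_min !lexx orbT.
have dda : d <= da by apply: le_trans ddw (le_trans dwe _); rewrite ge_min lexx.
have ddb : d <= db by apply: le_trans ddw (le_trans dwe _); rewrite ge_min lexx orbT.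
have key (t : R) : 0 < t < d -> exists ya yb,
  [/\ hasD t (1 : R) (fun s => (pa s - pb s) ^+ 2) (2 * t * ((ya - yb) * (pa t - pb t))),
     (ya - yb) * (pa t - pb t) <= 0,
     pa t = pb t -> ya = yb, ya != 0 & 
     phiT T i0 t = - (n%:R - 1) * ya * (t * derive1 ra t / ra t) /\
      phiT T i0 t = - (n%:R - 1) * yb * (t * derive1 rb t / rb t)].
  move=> /andP[t0 td].
  have ta : 0 < t < ea by rewrite t0 (lt_le_trans td)// (le_trans dda).
  have tb : 0 < t < eb by rewrite t0 (lt_le_trans td)// (le_trans ddb).
  have [ya [dya phya psya]] := solution_ode i01 rma gTa ta.
  have [yb [dyb phyb psyb]] := solution_ode i01 rmb gTb tb.
  have [rap ra1p] := radial_metric_pos rma ta; have [rbp rb1p] := radial_metric_pos rmb tb.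
  set ha := t * _ / _ in phya psya; set hb := t * _ / _ in phyb psyb.
  have ha0 : 0 < ha by rewrite /ha !mulr_gt0// invr_gt0.
  have hb0 : 0 < hb by rewrite /hb !mulr_gt0// invr_gt0.
  have cph : 0 < c * phiT T i0 t by apply: posc; rewrite gtr0_norm// (lt_le_trans td).
  have wp : 0 < 2 + pa t + pb t by apply: posw; rewrite gtr0_norm// (lt_le_trans td).
  set ph := phiT T i0 t in phya phyb cph *; set ps := psiT T i0 i1 t in psya psyb *.
  have n1 : 0 < n%:R - 1 :> R by rewrite subr_gt0 ltr1n.
  (* Positivity of [h] gives [y] the sign opposite to [c], which separates the two roots of the
     quadratic. *)
  have sign y h : 0 < h -> ph = - (n%:R - 1) * y * h -> c * y < 0.
    move=> h0 E; have : 0 < - ((n%:R - 1) * h * (c * y)) by move: cph; rewrite E; congr (0 < _); ring.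
    by rewrite oppr_gt0 pmulr_rlt0// mulr_gt0.
  have cya := sign _ _ ha0 phya; have cyb := sign _ _ hb0 phyb.
  have quad y h q : 0 < h -> ph = - (n%:R - 1) * y * h ->
      ps = - (y / h + (n%:R - 2) * (2 * q + q ^+ 2) / t ^+ 2) ->
      (n%:R - 1) * y ^+ 2 = ph * ps + ph * ((n%:R - 2) * (2 * q + q ^+ 2) / t ^+ 2).
    move=> h0 -> ->; field; by rewrite !gt_eqF.
  have qa := quad _ _ _ ha0 phya psya; have qb := quad _ _ _ hb0 phyb psyb.
  (* In the difference of the two quadratics [psi] cancels and [pa - pb] factors out, so the known
     signs of [ya + yb] and [phi] decide that of [(ya - yb) (pa - pb)]. *)
  have diff : (n%:R - 1) * (ya + yb) * (ya - yb) =
      ph * (n%:R - 2) * (pa t - pb t) * (2 + pa t + pb t) / t ^+ 2.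
    have -> : (n%:R - 1) * (ya + yb) * (ya - yb) = (n%:R - 1) * ya ^+ 2 - (n%:R - 1) * yb ^+ 2 by ring.
    by rewrite qa qb; field; rewrite gt_eqF.
  have sum0 : c * (ya + yb) < 0 by rewrite mulrDr -[ltRHS]addr0 ltrD.
  exists ya, yb; split=> //.
  - by apply: der_eq; [apply: derX; apply: derB; [exact: dya|exact: dyb]|rewrite /= expr1; ring].
  - rewrite -(pmulr_rle0 _ n1) -(nmulr_rge0 _ sum0).
    have -> : c * (ya + yb) * ((n%:R - 1) * ((ya - yb) * (pa t - pb t))) =
      (c * ph) * ((n%:R - 2) * ((pa t - pb t) ^+ 2 * (2 + pa t + pb t) / t ^+ 2)).
      transitivity (c * ((n%:R - 1) * (ya + yb) * (ya - yb)) * (pa t - pb t)); first by ring.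
      by rewrite diff; ring.
    rewrite mulr_ge0 ?(ltW cph)// mulr_ge0//; first by rewrite subr_ge0 ler_nat.
    by apply: divr_ge0 (sqr_ge0 _); apply: mulr_ge0 (sqr_ge0 _) (ltW wp).
  (* The alternative [ya + yb = 0] contradicts [sum0]. *)
  - move=> pE; move/eqP: diff; rewrite pE subrr mulr0 !mul0r !mulf_eq0 (gt_eqF n1)/=.
    rewrite subr_eq0 => /orP[/eqP y0|/eqP//].
    by rewrite y0 mulr0 ltxx in sum0.
  - by apply: contraTneq cya => ->; rewrite mulr0 ltxx.
exists d; split=> //; [exact: le_trans dae|exact: le_trans dbe|move=> t td].
have /andP[t0 tlt] := td.
have pE : pa t = pb t.
  (* Choice turns the pointwise derivatives from [key] into the derivative function that the mean
     value theorem expects. *)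
  have kk (s : R) : exists y, 0 < s < d -> hasD s (1 : R) (fun s => (pa s - pb s) ^+ 2) y /\ y <= 0.
    have [sd|] := boolP (0 < s < d); last by exists 0.
    have [ya [yb [D le0 _ _ _]]] := key s sd; exists (2 * s * ((ya - yb) * (pa s - pb s))) => _.
    by split=> //; apply: mulr_ge0_le0 => //; rewrite mulr_ge0// ltW//; case/andP: sd.
  have [Y YP] := choice kk.
  have [||s] := @MVT _ (fun s => (pa s - pb s) ^+ 2) Y 0 t t0.
  - move=> s; rewrite in_itv/= => /andP[s0 st].
    by have [] := YP s _; rewrite ?s0 ?(lt_trans st).
  - apply: (@within_CtOn _ d); rewrite ?oppr_lt0//.
    apply: (@CkOnX R 0); apply: (@CkOnB R 0).
      exact: (@CkOn_sub R 0 _ _ _ dda ca).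
    exact: (@CkOn_sub R 0 _ _ _ ddb cb).
  rewrite in_itv/= pa0 pb0 subrr expr0n subr0 => /andP[s0 st] E.
  have [_ Y0] : hasD s (1 : R) (fun s => (pa s - pb s) ^+ 2) (Y s) /\ Y s <= 0.
    by apply: YP; rewrite s0 (lt_trans st).
  apply/eqP; rewrite -subr_eq0 -sqrf_eq0 eq_le sqr_ge0 andbT.
  by move: E; rewrite /= subr0 => ->; apply: mulr_le0_ge0 => //; exact: ltW.
have [ya [yb [_ _ yE y0 [Ea Eb]]]] := key t td.
by split=> //; exists ya; split=> //; rewrite (yE pE).
Qed.

(** Equal profiles and equal [h] make [r'/r] and [f'] agree. Hence [rb / ra] and [fb - fa] are
    constants [la] and [mu], read off at [d / 2], and the metrics differ by [e^(2 mu) la^2]; the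
    origin follows by continuity. *)
Lemma solutions_homothetic : exists c d : R, [/\ 0 < c, 0 < d, d <= Num.min ea eb &
  forall x, eball d x -> gb x = c *: ga x].
Proof.
have [d [d0 da db H]] := profiles_agree.
have [sfa sra] := radial_metric_smooth rma; have [sfb srb] := radial_metric_smooth rmb.
have ina (t : R) : 0 < t < d -> 0 < t < ea by move=> /andP[-> td]; exact: lt_le_trans da.
have inb (t : R) : 0 < t < d -> 0 < t < eb by move=> /andP[-> td]; exact: lt_le_trans db.
have absa (t : R) : 0 < t < d -> `|t| < ea by move=> /ina/andP[t0 ?]; rewrite gtr0_norm.
have absb (t : R) : 0 < t < d -> `|t| < eb by move=> /inb/andP[t0 ?]; rewrite gtr0_norm.
have n1 : 0 < n%:R - 1 :> R by rewrite subr_gt0 ltr1n.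
have rel (t : R) : 0 < t < d -> [/\ 0 < ra t, 0 < rb t, derive1 ra t * rb t = derive1 rb t * ra t &
    derive1 fa t = derive1 fb t].
  move=> td; have [rap ra1p] := radial_metric_pos rma (ina t td).
  have [rbp rb1p] := radial_metric_pos rmb (inb t td).
  have [pE [y [y0 Ea Eb]]] := H t td; have /andP[t0 _] := td.
  have hE : derive1 ra t / ra t = derive1 rb t / rb t.
    apply: (mulfI (lt0r_neq0 t0)); rewrite !mulrA.
    apply: (@mulfI _ (- (n%:R - 1) * y)); last by rewrite -Ea -Eb.
    by rewrite mulf_neq0// oppr_eq0 gt_eqF.
  have rE : derive1 ra t * rb t = derive1 rb t * ra t.
    by move/eqP: hE; rewrite eqr_div ?lt0r_neq0// => /eqP.
  split=> //.
  have fE (f r : R -> R) : 0 < r t -> 0 < derive1 r t -> derive1 f t = profile f r t * (derive1 r t / r t).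
    by move=> r0 r10; rewrite /profile; field; rewrite !gt_eqF.
  by rewrite (fE fa ra)// (fE fb rb)// pE hE.
have d2 : 0 < d / 2 < d by apply/andP; split; lra.
pose la := rb (d / 2) / ra (d / 2).
have [ra2 rb2 _ _] := rel _ d2.
have la0 : 0 < la by rewrite divr_gt0.
have rE (t : R) : 0 < t < d -> rb t = la * ra t.
  move=> td; have [rap _ _ _] := rel t td.
  have : rb t / ra t = rb (d / 2) / ra (d / 2).
    apply: (@cst_on_interval _ (fun s => rb s / ra s) d) => // s sd; have [ras rbs E _] := rel s sd.
    apply: der_eq.
      apply: derM; first exact: (smoothOn_hasD srb (absb s sd)).
      by apply: derV; [rewrite gt_eqF|exact: (smoothOn_hasD sra (absa s sd))].
    have -> : derive1 rb s = derive1 ra s * rb s / ra s by rewrite E; field; rewrite gt_eqF.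
    by field; rewrite gt_eqF.
  by rewrite -/la => <-; field; rewrite gt_eqF.
pose mu := fb (d / 2) - fa (d / 2).
have fE (t : R) : 0 < t < d -> fb t = fa t + mu.
  move=> td; suff : fb t - fa t = fb (d / 2) - fa (d / 2).
    by rewrite -/mu => <-; ring.
  apply: (@cst_on_interval _ (fun s => fb s - fa s) d) => // s sd; have [_ _ _ E] := rel s sd.
  apply: der_eq.
    apply: derB; first exact: (smoothOn_hasD sfb (absb s sd)).
    exact: (smoothOn_hasD sfa (absa s sd)).
  by rewrite E subrr.
have r1E (t : R) : 0 < t < d -> derive1 rb t = la * derive1 ra t.
  move=> td; have [rap _ E _] := rel t td.
  apply: (mulIf (lt0r_neq0 rap)); rewrite -E rE//; ring.
pose C := expR (2 * mu) * la ^+ 2.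
have [[sga _ _] _ _ _ gpa] := rma; have [[sgb _ _] _ _ _ gpb] := rmb.
have off x : eball d x -> x != 0 -> gb x = C *: ga x.
  move=> xd x0; have xe : 0 < enorm x < d by rewrite enorm_gt0 x0.
  rewrite (gpa x (lt_le_trans xd da) x0) (gpb x (lt_le_trans xd db) x0).
  rewrite scalerDr !scalerA fE// rE// r1E// /C mulrDr expRD.
  by congr (_ *: _ + _ *: _); ring.
exists C, d; split=> //.
- by rewrite mulr_gt0 ?expR_gt0// exprn_gt0.
- by rewrite le_min da.
move=> x xd; have [->|x0] := eqVneq x 0; last exact: off.
apply/matrixP => i j; rewrite mxE.
have z0 (e : R) : 0 < e -> eball e (0 : 'rV[R]_n) by move=> e0; rewrite /eball/= enorm0.
apply: (@eq_at0 _ _ (fun x => gb x i j) (fun x => C * ga x i j) i0 d) => //.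
- exact: (smooth_on_continuous (sgb i j) (z0 _ eb0)).
- apply: (continuousM (@cst_continuous _ _ C _)).
  exact: (smooth_on_continuous (sga i j) (z0 _ ea0)).
move=> t /andP[t0 td]; rewrite off ?mxE//.
  by rewrite /eball/= enorm_scale_delta gtr0_norm.
by rewrite -enorm_eq0 enorm_scale_delta normr_eq0 gt_eqF.
Qed.

End TwoSolutions.
End Uniqueness.

(** * Existence *)

Section RadialMatrix.
Context {R : realType} {n : nat}.
Implicit Types (x w : 'rV[R]_n) (A q k : R).

Definition radmx A q x : 'M[R]_n := A *: (1%:M + q *: (x^T *m x)).

Lemma radmxE A q x i j : radmx A q x i j = A * ((i == j)%:R + q * x 0 i * x 0 j).
Proof. by rewrite !mxE big_ord1 !mxE mulrA. Qed.

Lemma radmx_sym A q x : (radmx A q x)^T = radmx A q x.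
Proof. by apply/matrixP => i j; rewrite mxE !radmxE eq_sym mulrAC. Qed.

Lemma radmx_rot A q x (B : 'M[R]_n) : B *m B^T = 1%:M ->
  B *m radmx A q (x *m B) *m B^T = radmx A q x.
Proof.
move=> BB; rewrite /radmx -scalemxAr -scalemxAl mulmxDr mulmxDl mulmx1 BB.
have -> : (x *m B)^T *m (x *m B) = B^T *m (x^T *m x) *m B by rewrite trmx_mul !mulmxA.
rewrite -scalemxAr -scalemxAl; congr (_ *: (_ + _ *: _)).
by rewrite !mulmxA BB mul1mx -(mulmxA _ B) BB mulmx1.
Qed.

(* [1 + (2k + k^2 |x|^2) x^T x] is the square of [1 + k x^T x]. *)
Lemma radmx_pos A k x w : 0 < A -> 1 + sqnorm x * k != 0 -> w != 0 ->
  0 < (w *m radmx A (2 * k + sqnorm x * k ^+ 2) x *m w^T) 0 0.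
Proof.
move=> A0 h0 w0; pose s := (w *m x^T) 0 0; pose u := w + (k * s) *: x.
have sE : w *m x^T = s%:M by rewrite [LHS]mx11_scalar.
have sE' : x *m w^T = s%:M by rewrite -[x]trmxK -trmx_mul sE tr_scalar_mx.
have xE : x *m x^T = (sqnorm x)%:M by rewrite [LHS]mx11_scalar sqnorm_mul.
have wE : w *m w^T = (sqnorm w)%:M by rewrite [LHS]mx11_scalar sqnorm_mul.
have uE : sqnorm u = sqnorm w + (2 * k + sqnorm x * k ^+ 2) * s ^+ 2.
  have uT : u^T = w^T + (k * s) *: x^T by rewrite /u linearD/= linearZ.
  rewrite -(sqnorm_mul u) uT /u mulmxDl !mulmxDr -!scalemxAl -!scalemxAr.
  by rewrite sE sE' xE wE !mxE eqxx !mulr1n; ring.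
have -> : (w *m radmx A (2 * k + sqnorm x * k ^+ 2) x *m w^T) 0 0 = A * sqnorm u.
  have xx : w *m (x^T *m x) *m w^T = (s ^+ 2)%:M.
    by rewrite mulmxA sE -mulmxA sE' -scalar_mxM expr2.
  rewrite uE /radmx; move: (2 * k + _) => q.
  rewrite -scalemxAr -scalemxAl mulmxDr mulmx1 mulmxDl -scalemxAr -scalemxAl xx wE.
  by rewrite !mxE eqxx !mulr1n.
apply: mulr_gt0 => //; rewrite -enorm_sqr exprn_gt0// enorm_gt0.
apply: contraNneq w0 => u0.
have : (u *m x^T) 0 0 = 0 by rewrite u0 mul0mx mxE.
rewrite /u mulmxDl -scalemxAl sE xE !mxE eqxx !mulr1n => E.
have : s * (1 + sqnorm x * k) = 0 by rewrite -E; ring.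
move/eqP; rewrite mulf_eq0 (negbTE h0) orbF => /eqP s0.
by move: u0; rewrite /u s0 mulr0 scale0r addr0 => ->.
Qed.

End RadialMatrix.

Section Existence.
Context {R : realType} {n : nat}.
Variables (T : 'rV[R]_n -> 'M[R]_n) (phi psi : R -> R) (i0 i1 : 'I_n).
Hypotheses (n2 : (2 <= n)%N) (i01 : i0 != i1).
Hypothesis Tsmooth : smooth_tensor_on [set: 'rV[R]_n] T.
Hypothesis Tnonsing : nonsingular_on [set: 'rV[R]_n] T.
Hypothesis Tpolar : polar_on [set: 'rV[R]_n] T phi (fun t => t ^+ 2 * psi t).

Lemma even_normal_form (h : R -> R) (c : R) : c != 0 -> smoothOn 1 h -> evenOn 1 h -> h 0 = c ->
  exists a, [/\ smoothOn 1 a, evenOn 1 a & forall t : R, `|t| < 1 -> h t = c * (1 + t ^+ 2 * a t)].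
Proof.
move=> c0 sh eh h0.
have [|||a [sa ea E]] := @even_smooth_div R 1 (fun t => h t / c - 1) ltr01.
- by move=> k; apply: CkOnB; [apply: CkOnM => //; exact: CkOn_cst|exact: CkOn_cst].
- by move=> t te; rewrite eh.
- by rewrite h0 divff// subrr.
by exists a; split=> // t te; rewrite -E//; field.
Qed.

Lemma solution_exists : exists (d : R) (g : 'rV[R]_n -> 'M[R]_n), 0 < d /\ radial_solution T d g.
Proof.
pose c := psiT T i0 i1 0.
have c0 : c != 0 by exact: (nonsingular_at0 i01 Tsmooth Tpolar).
have phi0 : phiT T i0 0 = c by exact: (phiT_psiT0 i01 Tsmooth Tpolar).
have [a [sa ea aE]] := even_normal_form c0 (phiT_smooth i0 Tsmooth 1) (@phiT_even _ _ _ _ _ i0 Tpolar 1) phi0.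
have [b [sb eb bE]] := even_normal_form c0 (psiT_smooth i0 i1 Tsmooth 1) (@psiT_even _ _ _ _ _ _ _ i01 Tpolar 1) erefl.
have [d1 [z [Z [[d10 d11 sz sZ] [ez eZ Ypos dz rel]]]]] := radial_ode n c ltr01 sa sb ea eb.
have [||d [d0 dd1 apos]] := @CtOn_pos R d1 (fun t => 1 + t ^+ 2 * a t) d10.
- apply: (@CkOnD R 0); first exact: CkOn_cst.
  apply: (@CkOnM R 0); first by apply: (@CkOnX R 0); exact: (@CkOn_id R 0).
  exact: (@CkOn_sub R 0 _ _ _ d11 (smoothOn_CtOn sa)).
- by rewrite expr0n mul0r addr0.
have lt1 (t : R) : `|t| < d -> `|t| < d1 by move=> td; exact: lt_le_trans dd1.
have d_1 : d <= 1 by exact: le_trans d11.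
have n1 : n%:R - 1 != 0 :> R by rewrite gt_eqF// subr_gt0 ltr1n.
pose Y t := 1 + t ^+ 2 * Z t.
have Y0 (t : R) : `|t| < d -> Y t != 0 by move=> td; rewrite gt_eqF// Ypos// lt1.
(* Chosen so that [h = (1 + t^2 a) / Y], which solves [phi = - (n-1) y h] for [y = 2 C Y], in a form
   visibly smooth at 0. *)
pose k t := (a t - Z t) / Y t.
pose h t := 1 + t ^+ 2 * k t.
have hE (t : R) : `|t| < d -> h t = (1 + t ^+ 2 * a t) / Y t.
  by move=> td; have := Y0 t td; rewrite /h /k /Y => y0; field.
have hpos (t : R) : `|t| < d -> 0 < h t.
  by move=> td; rewrite hE// divr_gt0 ?apos// Ypos// lt1.
pose C := - (c / (2 * (n%:R - 1))).
pose v t := C * (1 + t ^+ 2 * z t).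
pose m t := v t * h t.
have st2 : smoothOn d (fun t => t ^+ 2) by move=> j; apply: CkOnX; exact: CkOn_id.
have sz' : smoothOn d z by exact: smoothOn_sub sz.
have sZ' : smoothOn d Z by exact: smoothOn_sub sZ.
have sk : smoothOn d k.
  move=> j; apply: CkOnM; first by apply: CkOnB; [exact: (CkOn_sub d_1 (sa j))|exact: sZ'].
  apply: CkOnV => //; apply: CkOnD; first exact: CkOn_cst.
  by apply: CkOnM; [exact: st2|exact: sZ'].
have sh : smoothOn d h.
  by move=> j; apply: CkOnD; [exact: CkOn_cst|apply: CkOnM; [exact: st2|exact: sk]].
have sv : smoothOn d v.
  by move=> j; apply: CkOnZ; apply: CkOnD; [exact: CkOn_cst|apply: CkOnM; [exact: st2|exact: sz']].
have sm : smoothOn d m by move=> j; apply: CkOnM; [exact: sv|exact: sh].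
have ek : evenOn d k.
  by move=> t td; rewrite /k /Y sqrrN ea ?eZ ?lt1//; exact: lt_le_trans d_1.
have eh : evenOn d h by move=> t td; rewrite /h sqrrN ek.
have ev : evenOn d v by move=> t td; rewrite /v sqrrN ez// lt1.
have em : evenOn d m by move=> t td; rewrite /m ev// eh.
(* [K' = t k] makes [r = t e^K] satisfy [t r' / r = h], and [f' = t v h] then gives
   [f' r / r' = t^2 v]. *)
have [K [sK eK K0 dK]] := even_smooth_primitive sk ek.
have [f [sf ef f0 df]] := even_smooth_primitive sm em.
pose r t := t * expR (K t).
pose A t := expR (2 * (f t + K t)).
pose q t := 2 * k t + t ^+ 2 * k t ^+ 2.
pose g x := radmx (A (enorm x)) (q (enorm x)) x : 'M[R]_n.
have dr (t : R) : `|t| < d -> hasD t (1 : R) r (expR (K t) * h t).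
  move=> td; apply: der_eq.
    apply: derM; first exact: der_id.
    by apply: (@der_comp R R expR K); [exact: is_derive_expR|exact: dK].
  by rewrite /h; ring.
have r1E (t : R) : `|t| < d -> derive1 r t = expR (K t) * h t.
  by move=> td; rewrite derive1E (der_val (dr t td)).
have sr : smoothOn d r by move=> j; apply: CkOnM; [exact: CkOn_id|exact: CkOn_exp].
have sA : smoothOn d A.
  by move=> j; apply: CkOn_exp; apply: CkOnZ; apply: CkOnD; [exact: sf|exact: sK].
have sq : smoothOn d q.
  move=> j; apply: CkOnD; first by apply: CkOnZ; exact: sk.
  by apply: CkOnM; [exact: st2|apply: CkOnX; exact: sk].
have eA : evenOn d A by move=> t td; rewrite /A ef// eK.
have eq' : evenOn d q by move=> t td; rewrite /q sqrrN ek.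
have absn (x : 'rV[R]_n) : eball d x -> `|enorm x| < d by rewrite ger0_norm ?enorm_ge0.
have absd (t : R) : 0 <= t < d -> `|t| < d by move=> /andP[t0 td]; rewrite ger0_norm.
exists d, g; split=> //; split; first (exists f, r; split).
- split.
  + move=> i j; apply: (@radpoly_smooth _ _ d d0
      (fun x => A (enorm x) * ((i == j)%:R + q (enorm x) * x 0 i * x 0 j))).
      apply: radpolyM; first exact: radpoly_even.
      apply: radpolyD; first exact: radpoly_cst.
      apply: radpolyM; last exact: radpoly_coord.
      by apply: radpolyM; [exact: radpoly_even|exact: radpoly_coord].
    by move=> x _; rewrite /g radmxE.
  + by move=> x _; exact: radmx_sym.
  + move=> x xd w w0; rewrite /g /q enorm_sqr; apply: radmx_pos => //; first exact: expR_gt0.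
    by rewrite -enorm_sqr gt_eqF//; apply: hpos; exact: absn.
- by move=> B [BB _] x _; rewrite /pullback /g enorm_orthogonal// radmx_rot.
- by split; apply/smooth1_onP.
- split; first by rewrite /r mul0r.
    by rewrite r1E ?normr0// K0 expR0 /h expr0n mul0r addr0 mulr1.
  by move=> t /absd td; rewrite r1E// mulr_gt0 ?expR_gt0// hpos.
- move=> x xd x0; have E0 : enorm x != 0 by rewrite enorm_eq0.
  apply/matrixP => i j; rewrite /g radmxE.
  have S (M N : 'M[R]_n) (u w : R) : (u *: M + w *: N) i j = u * M i j + w * N i j by rewrite !mxE.
  have -> : A (enorm x) = expR (2 * f (enorm x)) * expR (K (enorm x)) ^+ 2.
    by rewrite /A mulrDr expRD [2 * K _]mulr_natl mulr2n expRD expr2.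
  rewrite S dt2E// dTheta2E// r1E ?absn// /q /r -enorm_sqr /h; field.
  exact: E0.
have [k1 [sk1 ek1 dk]] := even_smooth_D d0 sk ek.
have [k2 [_ _ dk1]] := even_smooth_D d0 sk1 ek1.
pose v1 t := 2 * C * (Z t - z t).
have dv (t : R) : `|t| < d -> hasD t (1 : R) v (t * v1 t).
  move=> td; have dzt := smoothOn_hasD sz' td; apply: der_eq.
    apply: derM; first exact: der_cst.
    apply: derD; first exact: der_cst.
    by apply: derM; [apply: derX; exact: der_id|exact: dzt].
  have [->|t0] := eqVneq t 0; first by rewrite /=; ring.
  rewrite (der_unique dzt (dz t (lt1 t td) t0)) /v1 /=; field.
  exact: t0.
have dA (t : R) : `|t| < d -> hasD t (1 : R) A (t * (2 * A t * (v t * h t + k t))).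
  move=> td; apply: der_eq.
    apply: (@der_comp R R expR (fun s => 2 * (f s + K s))); first exact: is_derive_expR.
    by apply: derM; [exact: der_cst|apply: derD; [exact: df|exact: dK]].
  by rewrite -/(A t) /m; ring.
move=> x xd; set t := enorm x.
have td := absn x xd; rewrite -/t in td.
have [||||P [Q [RE PE QE]]] := @Ric_radial_metric _ _ _ g (fun x => A (enorm x)) (fun x => k (enorm x))
  (fun x => v (enorm x)) _ _ _ (@open_eball R n d) _ _ (radD_enorm_even ek dk)
  (radD_enorm_even ev dv) (radD_enorm_even ek1 dk1) _ _ x xd.
- by move=> y yd i j; rewrite /g radmxE /q enorm_sqr.
- by apply: (radD_eq (radD_enorm_even eA dA)) => y yd; rewrite /h enorm_sqr.
- by move=> y yd; rewrite gt_eqF// expR_gt0.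
- by move=> y yd; rewrite -enorm_sqr gt_eqF// hpos// absn.
rewrite -enorm_sqr -/t -/(h t) in PE QE.
have y2 : 2 * v t + t ^+ 2 * v1 t = 2 * C * Y t by rewrite /v /v1 /Y; ring.
have Yt := Y0 t td; have at0 : 1 + t ^+ 2 * a t != 0 by rewrite gt_eqF// apos.
rewrite y2 hE// in PE QE.
have t1 : `|t| < 1 by exact: lt_le_trans d_1.
have phiE : P + t ^+ 2 * Q = phiT T i0 t.
  by rewrite QE aE// /C; field; rewrite Yt n1.
have psiE : P = psiT T i0 i1 t.
  rewrite PE bE//.
  (* Undoes the division by [t^2] in [rel], recovering the reduced equation. *)
  have YY : Y t ^+ 2 = (1 + t ^+ 2 * a t) * (1 + t ^+ 2 * ((n%:R - 1) * b t - (n%:R - 2) * z t +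
        (n%:R - 2) * c / (4 * (n%:R - 1)) * (1 + t ^+ 2 * z t) ^+ 2)).
    have -> : Y t ^+ 2 = 1 + t ^+ 2 * (2 * Z t + t ^+ 2 * Z t ^+ 2) by rewrite /Y; ring.
    by rewrite rel ?lt1//; ring.
  have -> : 2 * C * Y t / ((1 + t ^+ 2 * a t) / Y t) = 2 * C * (Y t ^+ 2 / (1 + t ^+ 2 * a t)).
    by field; rewrite at0 Yt.
  by rewrite YY /v /C; field; rewrite n1 at0.
apply/matrixP => i j; rewrite RE.
(* At the origin both sides are multiples of the identity, so the tangential equation [psiE]
   suffices. *)
have [x0|x0] := eqVneq x 0.
  rewrite x0 !mxE !mulr0 addr0 (polar_at0 i01 Tsmooth Tpolar) psiE.
  by rewrite /t x0 enorm0.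
have t0 : t != 0 by rewrite /t enorm_eq0.
rewrite (polar_entries Tpolar i j x0) -/t -enorm_sqr -/t.
rewrite -[t in phi t]ger0_norm ?enorm_ge0// -(phiTE i0 Tpolar t0) -[t in psi t]ger0_norm ?enorm_ge0//.
rewrite -(psiTE i01 Tpolar t0) -psiE -phiE; field.
exact: t0.
Qed.

End Existence.

Theorem mainTheorem1 (R : realType) (n : nat) (hn : (2 <= n)%N)
    (T : 'rV[R]_n -> 'M[R]_n) (phi psi : R -> R)
    (Tsmooth : smooth_tensor_on [set: 'rV[R]_n] T)
    (Tsym : symmetric_on [set: 'rV[R]_n] T)
    (Tnonsing : nonsingular_on [set: 'rV[R]_n] T)
    (Trot : rotationally_symmetric_on [set: 'rV[R]_n] T)
    (Tpolar : polar_on [set: 'rV[R]_n] T phi (fun t => t ^+ 2 * psi t)) :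
  (exists (e : R) (g : 'rV[R]_n -> 'M[R]_n), 0 < e /\ radial_solution T e g) /\
  (forall (e1 e2 : R) (g1 g2 : 'rV[R]_n -> 'M[R]_n),
     0 < e1 -> 0 < e2 ->
     radial_solution T e1 g1 -> radial_solution T e2 g2 ->
     exists c d : R,
       [/\ 0 < c, 0 < d, d <= Num.min e1 e2 &
           forall x, eball d x -> g2 x = c *: g1 x]).
Proof.
pose i0 : 'I_n := Ordinal (ltnW hn); pose i1 : 'I_n := Ordinal hn.
have i01 : i0 != i1 by [].
split; first exact: (solution_exists hn i01 Tsmooth Tnonsing Tpolar).
move=> e1 e2 g1 g2 e10 e20 [[f1 [r1 m1]] ric1] [[f2 [r2 m2]] ric2].
exact: (solutions_homothetic hn i01 Tsmooth Tnonsing Tpolar e10 e20 m1 m2 ric1 ric2).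
Qed.
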